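(* Let $\mathbf{H}\in\mathbb{H}^4$. The following are equivalent: (1) $\mathbf{H}$ is triclinic; (2) $\mathbf{Cov}_2(\mathbf{H})$ is triclinic; (3) the triple $(\mathbf{d}_2,\mathbf{c}_3,\mathbf{c}_4)$ is triclinic.
   Context: $\mathbb{H}^4$ is the space of totally symmetric traceless fourth-order tensors on $\mathbb{R}^3$, with $SO(3)$-action $(g\star\mathbf{T})(x_1,\dots,x_n)=\mathbf{T}(g^{-1}x_1,\dots,g^{-1}x_n)$. $\mathbf{Cov}_2(\mathbf{H})\subset\mathrm{Sym}^2(\mathbb{R}^3)$ is the set of values at $\mathbf{H}$ of all $SO(3)$-equivariant polynomial maps $\mathbb{H}^4\to\mathrm{Sym}^2(\mathbb{R}^3)$. $(\mathbf{H}:\mathbf{H})_{ijkl}=H_{ijmn}H_{mnkl}$, $(\mathbf{H}:\mathbf{a})_{ij}=H_{ijkl}a_{kl}$, $(\operatorname{tr}_{13}\mathbf{A})_{ij}=A_{kikj}$, $\mathbf{d}_2=\operatorname{tr}_{13}(\mathbf{H}:\mathbf{H})$, $\mathbf{c}_3=\mathbf{H}:\mathbf{d}_2$, $\mathbf{c}_4=\mathbf{H}:\mathbf{c}_3$. Symmetry group of a tensor: $\{g\in SO(3):g\star\mathbf{T}=\mathbf{T}\}$; of a family or subspace: intersection; symmetry class: conjugacy class. Triclinic means trivial symmetry group. *)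

(* Defs.v *)
From mathcomp Require Import all_boot all_order all_algebra all_fingroup.
From mathcomp Require Import reals.
Set Implicit Arguments. Unset Strict Implicit. Unset Printing Implicit Defensive.
Import Order.TTheory GRing.Theory Num.Theory.
Local Open Scope ring_scope.

Section H4Defs.
Variable R : realType.

Definition tensor4 := 'I_3 -> 'I_3 -> 'I_3 -> 'I_3 -> R.

Definition SO3 (g : 'M[R]_3) : Prop := g^T *m g = 1%:M /\ \det g = 1.

(* (g * T)(x1,..,x4) = T(g^-1 x1, .., g^-1 x4), i.e.
   (g * T)_{ijkl} = g_{ia} g_{jb} g_{kc} g_{ld} T_{abcd}  (g^-1 = g^T) *)
Definition act4 (g : 'M[R]_3) (T : tensor4) : tensor4 :=
  fun i j k l => \sum_(a < 3) \sum_(b < 3) \sum_(c < 3) \sum_(d < 3)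
      g i a * g j b * g k c * g l d * T a b c d.

Definition act2 (g : 'M[R]_3) (A : 'M[R]_3) : 'M[R]_3 := g *m A *m g^T.

Definition sym2 (A : 'M[R]_3) : Prop := A^T = A.

Definition tensor_at (T : tensor4) (idx : 'I_4 -> 'I_3) : R :=
  T (idx 0) (idx 1) (idx 2) (idx 3).

Definition totally_symmetric (T : tensor4) : Prop :=
  forall (s : 'S_4) (idx : 'I_4 -> 'I_3),
    tensor_at T (fun m => idx (s m)) = tensor_at T idx.

(* traceless: (for a totally symmetric tensor) the contraction on a pair of
   indices vanishes *)
Definition traceless (T : tensor4) : Prop :=
  forall k l : 'I_3, \sum_(i < 3) T i i k l = 0.

Definition isH4 (T : tensor4) : Prop := totally_symmetric T /\ traceless T.

Inductive polyfun : (tensor4 -> R) -> Prop :=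
| pf_const (c : R) : polyfun (fun _ => c)
| pf_coord (i j k l : 'I_3) : polyfun (fun T => T i j k l)
| pf_add f1 f2 : polyfun f1 -> polyfun f2 -> polyfun (fun T => f1 T + f2 T)
| pf_mul f1 f2 : polyfun f1 -> polyfun f2 -> polyfun (fun T => f1 T * f2 T)
| pf_ext f1 f2 : (forall T, f1 T = f2 T) -> polyfun f1 -> polyfun f2.

Definition equiv_poly_map (f : tensor4 -> 'M[R]_3) : Prop :=
  (forall i j : 'I_3, polyfun (fun T => f T i j)) /\
  (forall T, isH4 T -> sym2 (f T)) /\
  (forall g T, SO3 g -> isH4 T -> f (act4 g T) = act2 g (f T)).

Definition Cov2 (H : tensor4) (a : 'M[R]_3) : Prop :=
  exists f, equiv_poly_map f /\ a = f H.

Definition fixes4 (g : 'M[R]_3) (T : tensor4) : Prop :=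
  forall i j k l, act4 g T i j k l = T i j k l.

Definition triclinic4 (T : tensor4) : Prop :=
  forall g, SO3 g -> fixes4 g T -> g = 1%:M.

Definition triclinic2_family (F : 'M[R]_3 -> Prop) : Prop :=
  forall g, SO3 g -> (forall a, F a -> act2 g a = a) -> g = 1%:M.

Definition ddot44 (A B : tensor4) : tensor4 :=
  fun i j k l => \sum_(m < 3) \sum_(n < 3) A i j m n * B m n k l.
Definition ddot42 (A : tensor4) (a : 'M[R]_3) : 'M[R]_3 :=
  \matrix_(i, j) \sum_(k < 3) \sum_(l < 3) A i j k l * a k l.
Definition tr13 (A : tensor4) : 'M[R]_3 :=
  \matrix_(i, j) \sum_(k < 3) A k i k j.

Definition d2 (H : tensor4) : 'M[R]_3 := tr13 (ddot44 H H).
Definition c3 (H : tensor4) : 'M[R]_3 := ddot42 H (d2 H).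
Definition c4 (H : tensor4) : 'M[R]_3 := ddot42 H (c3 H).

End H4Defs.

(* Main.v *)
Require Import Defs.
From mathcomp Require Import all_boot all_order all_algebra all_fingroup.
From mathcomp Require Import boolp classical_sets reals ring lra.
From mathcomp Require Import topology normedtype derive.
Set Implicit Arguments. Unset Strict Implicit. Unset Printing Implicit Defensive.
Import Order.TTheory GRing.Theory Num.Theory.
Local Open Scope ring_scope.

(** Only the implication from (1) to (3) is substantial. Suppose that a rotation
    [g <> 1] fixes [d2 H], [c3 H] and [c4 H]. Its axis is a common eigenvector of
    the three matrices; in a frame with third axis along it and in which [d2 H]
    is diagonal, write [f x = H(e3, x, x, x)] for the binary cubic on the
    horizontal plane, and [u = d11 - d33], [v = d22 - d33] for the entries of
    [d2 H].

    If [(u, v) <> 0], the conditions on [c3] and [c4] say that [f] is apolar to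
    the horizontal parts of [d2] and of [c3], reduced modulo the identity. So
    either [f] is a cube of a linear form, and the equations for [d2] force a
    half-turn symmetry, or the deviator of [d2] is an eigentensor of [H]. In the
    second case, the equations for [d2] give a threefold symmetry if two of the
    eigenvalues of [d2] coincide. If they are distinct, either there is a
    half-turn about an axis of the frame, or the off-diagonal matrices
    [H12..], [H13..], [H23..] all have a nonzero diagonal; but then [H] would be
    cubic and [d2] scalar, a contradiction.

    If [d2 H] is scalar, take instead the third axis at a maximum of
    [H(x, x, x, x)] on the sphere, so that [H1333 = H2333 = 0], and make
    [H1233 = 0] by a rotation about it; then [H] has a half-turn or a threefold
    symmetry about this axis. *)

(** * The tensor action and its covariants *)

Section Slots.
Variable R : realType.
Implicit Types (T A B : tensor4 R) (g h : 'M[R]_3).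

(** The action factors into four one-index actions that commute across different indices, so
    equivariance of products and traces can be checked one index at a time. *)
Definition slot1 g T : tensor4 R := fun i j k l => \sum_(a < 3) g i a * T a j k l.
Definition slot2 g T : tensor4 R := fun i j k l => \sum_(a < 3) g j a * T i a k l.
Definition slot3 g T : tensor4 R := fun i j k l => \sum_(a < 3) g k a * T i j a l.
Definition slot4 g T : tensor4 R := fun i j k l => \sum_(a < 3) g l a * T i j k a.

Lemma tensorP T A : (forall i j k l, T i j k l = A i j k l) -> T = A.
Proof. by move=> e; do 4 (apply/funext=> ?); apply: e. Qed.

Lemma act4_slots g T : act4 g T = slot1 g (slot2 g (slot3 g (slot4 g T))).
Proof.
apply: tensorP => i j k l; rewrite /act4 /slot1 /slot2 /slot3 /slot4.
apply: eq_bigr => a _; rewrite mulr_sumr; apply: eq_bigr => b _.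
rewrite mulrA mulr_sumr; apply: eq_bigr => c _.
rewrite !mulrA mulr_sumr; apply: eq_bigr => d _.
by rewrite !mulrA.
Qed.

Lemma sum_delta (F : 'I_3 -> R) i :
  \sum_(a < 3) (1%:M : 'M[R]_3) i a * F a = F i.
Proof.
rewrite (bigD1 i) //= mxE eqxx mul1r big1 ?addr0 // => a ai.
by rewrite mxE eq_sym (negPf ai) mul0r.
Qed.

Lemma sum_contract g h (F : 'I_3 -> R) i :
  \sum_(a < 3) g i a * (\sum_(b < 3) h a b * F b) =
  \sum_(b < 3) (g *m h) i b * F b.
Proof.
under eq_bigr do rewrite mulr_sumr.
rewrite exchange_big; apply: eq_bigr => b _.
by rewrite mxE mulr_suml; apply: eq_bigr => c _; rewrite mulrA.
Qed.

Lemma sum_swap (x y : 'I_3 -> R) (F : 'I_3 -> 'I_3 -> R) :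
  \sum_(a < 3) x a * (\sum_(b < 3) y b * F a b) =
  \sum_(b < 3) y b * (\sum_(a < 3) x a * F a b).
Proof.
under eq_bigr do rewrite mulr_sumr.
under [RHS]eq_bigr do rewrite mulr_sumr.
by rewrite exchange_big; do 2 (apply: eq_bigr => ? _); rewrite mulrCA.
Qed.

Lemma slot11 g h T : slot1 g (slot1 h T) = slot1 (g *m h) T.
Proof. by apply: tensorP => i j k l; apply: sum_contract. Qed.
Lemma slot22 g h T : slot2 g (slot2 h T) = slot2 (g *m h) T.
Proof. by apply: tensorP => i j k l; apply: sum_contract. Qed.
Lemma slot33 g h T : slot3 g (slot3 h T) = slot3 (g *m h) T.
Proof. by apply: tensorP => i j k l; apply: sum_contract. Qed.
Lemma slot44 g h T : slot4 g (slot4 h T) = slot4 (g *m h) T.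
Proof. by apply: tensorP => i j k l; apply: sum_contract. Qed.
Lemma slot21 g h T : slot2 g (slot1 h T) = slot1 h (slot2 g T).
Proof. by apply: tensorP => i j k l; apply: sum_swap. Qed.
Lemma slot31 g h T : slot3 g (slot1 h T) = slot1 h (slot3 g T).
Proof. by apply: tensorP => i j k l; apply: sum_swap. Qed.
Lemma slot41 g h T : slot4 g (slot1 h T) = slot1 h (slot4 g T).
Proof. by apply: tensorP => i j k l; apply: sum_swap. Qed.
Lemma slot32 g h T : slot3 g (slot2 h T) = slot2 h (slot3 g T).
Proof. by apply: tensorP => i j k l; apply: sum_swap. Qed.
Lemma slot42 g h T : slot4 g (slot2 h T) = slot2 h (slot4 g T).
Proof. by apply: tensorP => i j k l; apply: sum_swap. Qed.
Lemma slot43 g h T : slot4 g (slot3 h T) = slot3 h (slot4 g T).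
Proof. by apply: tensorP => i j k l; apply: sum_swap. Qed.

Lemma act4M g h T : act4 g (act4 h T) = act4 (g *m h) T.
Proof.
rewrite !act4_slots !(slot41, slot42, slot43) slot44.
by rewrite !(slot31, slot32) slot33 !slot21 slot22 slot11.
Qed.

Lemma act4_1 T : act4 1%:M T = T.
Proof.
apply: tensorP => i j k l.
by rewrite act4_slots /slot1 sum_delta /slot2 sum_delta /slot3 sum_delta
  /slot4 sum_delta.
Qed.

Lemma sum_pull_l (x : 'I_3 -> R) (F : 'I_3 -> 'I_3 -> 'I_3 -> R) G :
  \sum_(m < 3) \sum_(n < 3) (\sum_(c < 3) x c * F c m n) * G m n =
  \sum_(c < 3) x c * (\sum_(m < 3) \sum_(n < 3) F c m n * G m n).
Proof.
under [RHS]eq_bigr do rewrite mulr_sumr.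
rewrite [RHS]exchange_big; apply: eq_bigr => m _.
under [RHS]eq_bigr do rewrite mulr_sumr.
rewrite [RHS]exchange_big; apply: eq_bigr => n _.
by rewrite mulr_suml; apply: eq_bigr => c _; rewrite mulrA.
Qed.

Lemma sum_pull_r (x : 'I_3 -> R) (F : 'I_3 -> 'I_3 -> 'I_3 -> R) G :
  \sum_(m < 3) \sum_(n < 3) G m n * (\sum_(c < 3) x c * F c m n) =
  \sum_(c < 3) x c * (\sum_(m < 3) \sum_(n < 3) G m n * F c m n).
Proof.
under eq_bigr do under eq_bigr do rewrite mulrC.
rewrite sum_pull_l; apply: eq_bigr => c _; congr (_ * _).
by do 2 (apply: eq_bigr => ? _); rewrite mulrC.
Qed.

Lemma ddot44_slot1 g A B : ddot44 (slot1 g A) B = slot1 g (ddot44 A B).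
Proof. by apply: tensorP => i j k l; apply: sum_pull_l. Qed.
Lemma ddot44_slot2 g A B : ddot44 (slot2 g A) B = slot2 g (ddot44 A B).
Proof. by apply: tensorP => i j k l; apply: sum_pull_l. Qed.
Lemma ddot44_slot3r g A B : ddot44 A (slot3 g B) = slot3 g (ddot44 A B).
Proof. apply: tensorP => i j k l; exact: (sum_pull_r (g k) (fun c m n => B m n c l)). Qed.
Lemma ddot44_slot4r g A B : ddot44 A (slot4 g B) = slot4 g (ddot44 A B).
Proof. apply: tensorP => i j k l; exact: (sum_pull_r (g l) (fun c m n => B m n k c)). Qed.

Lemma sum_transfer g (F G : 'I_3 -> R) :
  \sum_(m < 3) (\sum_(a < 3) g m a * F a) * G m =
  \sum_(a < 3) F a * (\sum_(m < 3) g^T a m * G m).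
Proof.
under eq_bigr do rewrite mulr_suml.
under [RHS]eq_bigr do rewrite mulr_sumr.
rewrite exchange_big; do 2 (apply: eq_bigr => ? _).
by rewrite mxE mulrA [F _ * _]mulrC.
Qed.

Lemma ddot44_slot3l g A B : ddot44 (slot3 g A) B = ddot44 A (slot1 g^T B).
Proof.
apply: tensorP => i j k l; rewrite /ddot44 /slot3 /slot1.
rewrite exchange_big [RHS]exchange_big; apply: eq_bigr => n _.
exact: (sum_transfer g (fun m => A i j m n) (fun m => B m n k l)).
Qed.
Lemma ddot44_slot4l g A B : ddot44 (slot4 g A) B = ddot44 A (slot2 g^T B).
Proof.
apply: tensorP => i j k l; rewrite /ddot44 /slot4 /slot2.
by apply: eq_bigr => n _; apply: sum_transfer.
Qed.

(** The factors [g] on the two contracted indices of [A] move to [B] as [g^T] and cancel the factors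
    [g] already there. *)
Lemma ddot44_act g A B : g^T *m g = 1%:M ->
  ddot44 (act4 g A) (act4 g B) = act4 g (ddot44 A B).
Proof.
move=> gg; rewrite (act4_slots g A) ddot44_slot1 ddot44_slot2 ddot44_slot3l.
rewrite ddot44_slot4l act4_slots slot11 gg slot21 slot22 gg.
rewrite act4_slots -ddot44_slot4r -ddot44_slot3r; congr (slot1 _ (slot2 _ _)).
have slot1_1 T : slot1 1%:M T = T by apply: tensorP => i j k l; apply: sum_delta.
have slot2_1 T : slot2 1%:M T = T by apply: tensorP => i j k l; apply: sum_delta.
by rewrite slot1_1 slot2_1.
Qed.

Lemma tr13_slot2 g A : tr13 (slot2 g A) = g *m tr13 A.
Proof.
apply/matrixP => i j; rewrite !mxE /slot2 exchange_big; apply: eq_bigr => a _.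
by rewrite mxE mulr_sumr.
Qed.
Lemma tr13_slot4 g A : tr13 (slot4 g A) = tr13 A *m g^T.
Proof.
apply/matrixP => i j; rewrite !mxE /slot4 exchange_big; apply: eq_bigr => a _.
by rewrite !mxE mulr_suml; apply: eq_bigr => k _; rewrite mulrC.
Qed.

Lemma sum_orth g (F : 'I_3 -> 'I_3 -> R) : g^T *m g = 1%:M ->
  \sum_(k < 3) \sum_(a < 3) g k a * (\sum_(b < 3) g k b * F a b) =
  \sum_(a < 3) F a a.
Proof.
move=> gg; rewrite exchange_big; apply: eq_bigr => a _.
transitivity (\sum_(b < 3) (g^T *m g) a b * F a b).
  under [RHS]eq_bigr do rewrite mxE mulr_suml.
  rewrite [RHS]exchange_big; apply: eq_bigr => k _.
  by rewrite mulr_sumr; apply: eq_bigr => b _; rewrite mxE mulrA.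
by rewrite gg sum_delta.
Qed.

Lemma tr13_slot13 g A : g^T *m g = 1%:M -> tr13 (slot1 g (slot3 g A)) = tr13 A.
Proof.
move=> gg; apply/matrixP => i j; rewrite !mxE.
exact: (sum_orth (fun a b => A a i b j) gg).
Qed.

Lemma tr13_act g A : g^T *m g = 1%:M -> tr13 (act4 g A) = act2 g (tr13 A).
Proof.
move=> gg; rewrite act4_slots -slot21 tr13_slot2 tr13_slot13 // tr13_slot4.
by rewrite /act2 mulmxA.
Qed.

Lemma ddot42_slot1 g A a : ddot42 (slot1 g A) a = g *m ddot42 A a.
Proof.
apply/matrixP => i j; rewrite !mxE sum_pull_l.
by apply: eq_bigr => k _; rewrite mxE.
Qed.
Lemma ddot42_slot2 g A a : ddot42 (slot2 g A) a = ddot42 A a *m g^T.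
Proof.
apply/matrixP => i j; rewrite !mxE sum_pull_l.
by apply: eq_bigr => k _; rewrite !mxE mulrC.
Qed.
Lemma ddot42_slot3 g A a : ddot42 (slot3 g A) a = ddot42 A (g^T *m a).
Proof.
apply/matrixP => i j; rewrite !mxE exchange_big [RHS]exchange_big.
apply: eq_bigr => l _.
rewrite (sum_transfer g (fun k => A i j k l) (fun k => a k l)).
by apply: eq_bigr => k _; rewrite mxE.
Qed.
Lemma ddot42_slot4 g A a : ddot42 (slot4 g A) a = ddot42 A (a *m g).
Proof.
apply/matrixP => i j; rewrite !mxE; apply: eq_bigr => k _.
rewrite sum_transfer; apply: eq_bigr => l _; rewrite mxE; congr (_ * _).
by apply: eq_bigr => m _; rewrite mxE mulrC.
Qed.

Lemma ddot42_act g A a : g^T *m g = 1%:M ->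
  ddot42 (act4 g A) (act2 g a) = act2 g (ddot42 A a).
Proof.
move=> gg; rewrite act4_slots ddot42_slot1 ddot42_slot2 ddot42_slot3.
by rewrite ddot42_slot4 /act2 !mulmxA gg mul1mx -(mulmxA a) gg mulmx1.
Qed.

Lemma d2_act g T : g^T *m g = 1%:M -> d2 (act4 g T) = act2 g (d2 T).
Proof. by move=> gg; rewrite /d2 ddot44_act // tr13_act. Qed.
Lemma c3_act g T : g^T *m g = 1%:M -> c3 (act4 g T) = act2 g (c3 T).
Proof. by move=> gg; rewrite /c3 d2_act // ddot42_act. Qed.
Lemma c4_act g T : g^T *m g = 1%:M -> c4 (act4 g T) = act2 g (c4 T).
Proof. by move=> gg; rewrite /c4 c3_act // ddot42_act. Qed.

(** The three adjacent transpositions generate all permutations of the indices, so these equations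
    express total symmetry in a form suited to rewriting. *)
Definition is_harmonic T : Prop :=
  [/\ forall i j k l, T j i k l = T i j k l,
      forall i j k l, T i k j l = T i j k l,
      forall i j k l, T i j l k = T i j k l
    & traceless T].

Lemma isH4_harmonic T : isH4 T -> is_harmonic T.
Proof.
case=> Tsym Ttr; split=> //.
- move=> i j k l.
  have := Tsym (tperm 0 1) (fun m => nth i [:: i; j; k; l] m).
  by rewrite /tensor_at /= !permE.
- move=> i j k l.
  have := Tsym (tperm 1 2) (fun m => nth i [:: i; j; k; l] m).
  by rewrite /tensor_at /= !permE.
- move=> i j k l.
  have := Tsym (tperm 2 3) (fun m => nth i [:: i; j; k; l] m).
  by rewrite /tensor_at /= !permE.
Qed.

Lemma act4_harmonic g T : g^T *m g = 1%:M -> is_harmonic T ->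
  is_harmonic (act4 g T).
Proof.
move=> gg [T12 T23 T34 Ttr]; split.
- move=> i j k l; rewrite /act4 exchange_big; apply: eq_bigr => b _.
  apply: eq_bigr => a _; apply: eq_bigr => c _; apply: eq_bigr => d _.
  by rewrite T12 [g j _ * _]mulrC.
- move=> i j k l; rewrite /act4; apply: eq_bigr => a _.
  rewrite exchange_big; apply: eq_bigr => c _.
  apply: eq_bigr => b _; apply: eq_bigr => d _.
  by rewrite T23 [g i _ * _ * _]mulrAC.
- move=> i j k l; rewrite /act4; do 2 (apply: eq_bigr => ? _).
  rewrite exchange_big; do 2 (apply: eq_bigr => ? _).
  by rewrite T34 [_ * g l _ * _]mulrAC.
- move=> k l; rewrite act4_slots.
  rewrite [LHS](sum_orth (fun a b => slot3 g (slot4 g T) a b k l) gg).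
  rewrite /slot3 /slot4 exchange_big big1 // => c _.
  rewrite -mulr_sumr exchange_big big1 ?mulr0 // => d _.
  by rewrite -mulr_sumr Ttr mulr0.
Qed.
End Slots.

(** * Coordinates of harmonic tensors *)

Definition x1 : 'I_3 := ord0.
Definition x2 : 'I_3 := lift ord0 ord0.
Definition x3 : 'I_3 := lift ord0 (lift ord0 ord0).

Lemma ord3P (P : 'I_3 -> Prop) : P x1 -> P x2 -> P x3 -> forall i, P i.
Proof.
move=> P1 P2 P3 [[|[|[|//]]] lti].
- by rewrite (_ : Ordinal lti = x1) //; apply: val_inj.
- by rewrite (_ : Ordinal lti = x2) //; apply: val_inj.
- by rewrite (_ : Ordinal lti = x3) //; apply: val_inj.
Qed.

Section Coordinates.
Variable R : realType.
Implicit Types (T : tensor4 R) (g h : 'M[R]_3).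

Lemma sum3 (F : 'I_3 -> R) : \sum_(i < 3) F i = F x1 + F x2 + F x3.
Proof. by rewrite !big_ord_recl big_ord0 addr0 addrA. Qed.

Definition occ (n i j k l : nat) : nat :=
  ((i == n) + (j == n) + (k == n) + (l == n))%N.

(* Only the numbers of indices 1 and 2 matter, and tracelessness determines the
   entries with two or more indices 3: [al, be, ga, de, ep] stand for [H1111],
   [H1122], [H2222], [H1112], [H1222] and [a, b, c, d] for [H1113], [H1223],
   [H1123], [H2223]. *)
Definition htensor (al be ga de ep a b c d : R) : tensor4 R :=
  fun i j k l =>
  match occ 0 i j k l, occ 1 i j k l with
  | 4%N, 0%N => al | 3%N, 1%N => de | 2%N, 2%N => be | 1%N, 3%N => ep | 0%N, 4%N => ga
  | 3%N, 0%N => a | 2%N, 1%N => c | 1%N, 2%N => b | 0%N, 3%N => d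
  | 2%N, 0%N => - (al + be) | 1%N, 1%N => - (de + ep) | 0%N, 2%N => - (be + ga)
  | 1%N, 0%N => - (a + b) | 0%N, 1%N => - (c + d)
  | _, _ => al + 2 * be + ga
  end.

Lemma harmonic_eq T : is_harmonic T ->
  T = htensor (T x1 x1 x1 x1) (T x1 x1 x2 x2) (T x2 x2 x2 x2) (T x1 x1 x1 x2)
              (T x1 x2 x2 x2) (T x1 x1 x1 x3) (T x1 x2 x2 x3) (T x1 x1 x2 x3)
              (T x2 x2 x2 x3).
Proof.
move=> [T12 T23 T34 Ttr].
have S21 := T12 x1 x2. have S31 := T12 x1 x3. have S32 := T12 x2 x3.
have U21 i := T23 i x1 x2. have U31 i := T23 i x1 x3. have U32 i := T23 i x2 x3.
have V21 i j := T34 i j x1 x2.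
have V31 i j := T34 i j x1 x3. have V32 i j := T34 i j x2 x3.
(* Rewriting with this tuple sorts the indices of each entry in increasing order; only linear trace
   relations are then left. *)
pose E := (S21, S31, S32, U21, U31, U32, V21, V31, V32).
have tr k l : T x1 x1 k l + T x2 x2 k l + T x3 x3 k l = 0 by rewrite -(Ttr k l) sum3.
have t11 := tr x1 x1. have t12 := tr x1 x2. have t13 := tr x1 x3.
have t22 := tr x2 x2. have t23 := tr x2 x3. have t33 := tr x3 x3.
rewrite !E in t11 t12 t13 t22 t23 t33.
apply: tensorP.
do 4 (apply: ord3P); rewrite /htensor /occ /= ?E; try done; lra.
Qed.

Lemma htensor_harmonic (al be ga de ep a b c d : R) :
  is_harmonic (htensor al be ga de ep a b c d).
Proof.
split.
- by do 4 (apply: ord3P).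
- by do 4 (apply: ord3P).
- by do 4 (apply: ord3P).
- by do 2 (apply: ord3P); rewrite sum3 /htensor /occ /=; ring.
Qed.

(** * Entries of [d2] and of contractions in these coordinates *)

Section Entries.
Variables al be ga de ep a b c d : R.
Let T := htensor al be ga de ep a b c d.

Lemma d2_13 : d2 T x1 x3 =
  - (2 * be + ga) * a + (2 * al + be - 4 * ga) * b - 3 * ep * c
  + (3 * de + 4 * ep) * d.
Proof. by rewrite /d2 /tr13 /ddot44 mxE !sum3 /T /htensor /occ /=; ring. Qed.

Lemma d2_23 : d2 T x2 x3 =
  - (2 * be + al) * d + (2 * ga + be - 4 * al) * c - 3 * de * b
  + (3 * ep + 4 * de) * a.
Proof. by rewrite /d2 /tr13 /ddot44 mxE !sum3 /T /htensor /occ /=; ring. Qed.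

Lemma d2_12 : d2 T x1 x2 =
  al * de + ep * ga + 3 * be * (de + ep) + 3 * (de + ep) * (al + 2 * be + ga)
  + 3 * a * c + 6 * b * c + 3 * b * d + (a + b) * (c + d).
Proof. by rewrite /d2 /tr13 /ddot44 mxE !sum3 /T /htensor /occ /=; ring. Qed.

Lemma d2_11_33 : d2 T x1 x1 - d2 T x3 x3 =
  al ^+ 2 + 3 * de ^+ 2 + 3 * be ^+ 2 + ep ^+ 2 + 2 * a ^+ 2 + 3 * c ^+ 2
  - d ^+ 2 - 3 * (de + ep) ^+ 2 - 2 * (a + b) ^+ 2 - 3 * (be + ga) ^+ 2
  - 3 * (c + d) ^+ 2 - (al + 2 * be + ga) ^+ 2.
Proof. by rewrite /d2 /tr13 /ddot44 !mxE !sum3 /T /htensor /occ /=; ring. Qed.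

Lemma d2_22_33 : d2 T x2 x2 - d2 T x3 x3 =
  ga ^+ 2 + 3 * ep ^+ 2 + 3 * be ^+ 2 + de ^+ 2 + 2 * d ^+ 2 + 3 * b ^+ 2
  - a ^+ 2 - 3 * (de + ep) ^+ 2 - 2 * (c + d) ^+ 2 - 3 * (al + be) ^+ 2
  - 3 * (a + b) ^+ 2 - (al + 2 * be + ga) ^+ 2.
Proof. by rewrite /d2 /tr13 /ddot44 !mxE !sum3 /T /htensor /occ /=; ring. Qed.

Section Contraction.
Variable D : 'M[R]_3.
Hypotheses (D21 : D x2 x1 = D x1 x2) (D13 : D x1 x3 = 0) (D23 : D x2 x3 = 0)
  (D31 : D x3 x1 = 0) (D32 : D x3 x2 = 0).
(** Since [T] is traceless, its contraction with [D] depends on [D] only modulo the identity, hence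
    on these differences and [y]. The entries 13 and 23 below are the apolar pairing of the
    horizontal part of [D] with the binary cubic [f]. *)
Let u := D x1 x1 - D x3 x3.
Let v := D x2 x2 - D x3 x3.
Let y := D x1 x2.

Let DE := (D21, D13, D23, D31, D32).

Lemma ddot42_13 : ddot42 T D x1 x3 = u * a + v * b + 2 * y * c.
Proof. by rewrite /u /v /y mxE !sum3 !DE /T /htensor /occ /=; ring. Qed.
Lemma ddot42_23 : ddot42 T D x2 x3 = u * c + v * d + 2 * y * b.
Proof. by rewrite /u /v /y mxE !sum3 !DE /T /htensor /occ /=; ring. Qed.
Lemma ddot42_12 : ddot42 T D x1 x2 = u * de + v * ep + 2 * y * be.
Proof. by rewrite /u /v /y mxE !sum3 !DE /T /htensor /occ /=; ring. Qed.
Lemma ddot42_11_33 : ddot42 T D x1 x1 - ddot42 T D x3 x3 =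
  u * (2 * al + be) + v * (2 * be + ga) + 2 * y * (2 * de + ep).
Proof. by rewrite /u /v /y !mxE !sum3 !DE /T /htensor /occ /=; ring. Qed.
Lemma ddot42_22_33 : ddot42 T D x2 x2 - ddot42 T D x3 x3 =
  u * (al + 2 * be) + v * (be + 2 * ga) + 2 * y * (de + 2 * ep).
Proof. by rewrite /u /v /y !mxE !sum3 !DE /T /htensor /occ /=; ring. Qed.
End Contraction.
End Entries.

Lemma ddot42_sym T D : is_harmonic T -> sym2 (ddot42 T D).
Proof.
move=> [T12 _ _ _]; apply/matrixP => i j; rewrite !mxE.
by do 2 (apply: eq_bigr => ? _); rewrite T12.
Qed.

Lemma d2_sym T : is_harmonic T -> sym2 (d2 T).
Proof.
move=> [T12 T23 T34 _]; apply/matrixP => i j; rewrite !mxE /ddot44.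
apply: eq_bigr => k _; apply: eq_bigr => m _; apply: eq_bigr => n _.
have pair_swap p q : T m n p q = T p q m n by rewrite T23 T12 T34 T23.
by rewrite !pair_swap mulrC.
Qed.

(** * Explicit rotations and tensors with a symmetry *)

Definition mx3 (m11 m12 m13 m21 m22 m23 m31 m32 m33 : R) : 'M[R]_3 :=
  \matrix_(i, j) nth 0 (nth [::] [:: [:: m11; m12; m13]; [:: m21; m22; m23];
    [:: m31; m32; m33]] i) j.

Lemma det_mx3 (m11 m12 m13 m21 m22 m23 m31 m32 m33 : R) :
  \det (mx3 m11 m12 m13 m21 m22 m23 m31 m32 m33) =
  m11 * (m22 * m33 - m23 * m32) - m12 * (m21 * m33 - m23 * m31)
  + m13 * (m21 * m32 - m22 * m31).
Proof.
rewrite (expand_det_row _ x1) sum3 /cofactor !mxE /=.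
rewrite !(expand_det_row _ ord0) !big_ord_recl !big_ord0 /cofactor.
rewrite !mxE /= !det_mx11 !mxE /=.
ring.
Qed.

Lemma mx3_row (m11 m12 m13 m21 m22 m23 m31 m32 m33 : R) (F : 'I_3 -> R) :
  let g := mx3 m11 m12 m13 m21 m22 m23 m31 m32 m33 in
  (\sum_(a < 3) g x1 a * F a = m11 * F x1 + m12 * F x2 + m13 * F x3) *
  (\sum_(a < 3) g x2 a * F a = m21 * F x1 + m22 * F x2 + m23 * F x3) *
  (\sum_(a < 3) g x3 a * F a = m31 * F x1 + m32 * F x2 + m33 * F x3).
Proof. by move=> g; split; [split|]; rewrite sum3 !mxE. Qed.

Definition has_symmetry T := exists2 g : 'M[R]_3, SO3 g & g <> 1%:M /\ act4 g T = T.

Lemma SO3_trmx g : SO3 g -> SO3 g^T /\ g *m g^T = 1%:M.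
Proof.
move=> [gg dg]; have gg' := mulmx1C gg.
by split=> //; split; rewrite ?trmxK ?det_tr.
Qed.

Lemma SO3M g h : SO3 g -> SO3 h -> SO3 (g *m h).
Proof.
move=> [gg dg] [hh dh]; split; last by rewrite det_mulmx dg dh mulr1.
by rewrite trmx_mul mulmxA -(mulmxA h^T) gg mulmx1.
Qed.

(** Conjugation by [P] carries the symmetry back, so the orthonormal frame may be chosen freely. *)
Lemma has_symmetry_act P T : SO3 P -> has_symmetry (act4 P T) -> has_symmetry T.
Proof.
move=> oP [g og [g1 gT]]; have [oPt PP] := SO3_trmx oP.
exists (P^T *m g *m P); first by do 2 (apply: SO3M => //).
split.
  move=> e; apply: g1; have := congr1 (fun m => P *m m *m P^T) e.
  by rewrite !mulmxA PP mul1mx -mulmxA PP !mulmx1 PP.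
by rewrite -act4M -act4M gT act4M (proj1 oP) act4_1.
Qed.

Lemma htensor_fix g al be ga de ep a b c d : g^T *m g = 1%:M ->
  let T := htensor al be ga de ep a b c d in
  let T' := act4 g T in
  T' x1 x1 x1 x1 = al -> T' x1 x1 x2 x2 = be -> T' x2 x2 x2 x2 = ga ->
  T' x1 x1 x1 x2 = de -> T' x1 x2 x2 x2 = ep -> T' x1 x1 x1 x3 = a ->
  T' x1 x2 x2 x3 = b -> T' x1 x1 x2 x3 = c -> T' x2 x2 x2 x3 = d -> T' = T.
Proof.
move=> gg T T'; have hT' := act4_harmonic gg (htensor_harmonic al be ga de ep a b c d).
move=> e1 e2 e3 e4 e5 e6 e7 e8 e9; have := harmonic_eq hT'.
by rewrite -/T -/T' e1 e2 e3 e4 e5 e6 e7 e8 e9.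
Qed.

Lemma SO3_mx3 (m11 m12 m13 m21 m22 m23 m31 m32 m33 : R) :
  m11 ^+ 2 + m21 ^+ 2 + m31 ^+ 2 = 1 -> m12 ^+ 2 + m22 ^+ 2 + m32 ^+ 2 = 1 ->
  m13 ^+ 2 + m23 ^+ 2 + m33 ^+ 2 = 1 ->
  m11 * m12 + m21 * m22 + m31 * m32 = 0 ->
  m11 * m13 + m21 * m23 + m31 * m33 = 0 ->
  m12 * m13 + m22 * m23 + m32 * m33 = 0 ->
  m11 * (m22 * m33 - m23 * m32) - m12 * (m21 * m33 - m23 * m31)
  + m13 * (m21 * m32 - m22 * m31) = 1 ->
  SO3 (mx3 m11 m12 m13 m21 m22 m23 m31 m32 m33).
Proof.
move=> e11 e22 e33 e12 e13 e23 ed; split; last by rewrite det_mx3.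
by apply/matrixP; do 2 (apply: ord3P); rewrite !mxE sum3 !mxE /=; lra.
Qed.

(** The half-turn about the first axis changes the sign of the entries with an odd number of indices
    different from 1, and these are the ones set to zero. The next two lemmas do the same for the
    other axes. *)
Lemma has_symmetry_C2_1 al be ga c d :
  has_symmetry (htensor al be ga 0 0 0 0 c d).
Proof.
have oP : SO3 (mx3 1 0 0 0 (-1) 0 0 0 (-1)) by apply: SO3_mx3; ring.
exists (mx3 1 0 0 0 (-1) 0 0 0 (-1)) => //; split.
  by move/matrixP/(_ x2 x2); rewrite !mxE /=; lra.
apply: htensor_fix; first by case: oP.
all: rewrite act4_slots /slot1 /slot2 /slot3 /slot4 !mx3_row /htensor /occ /=; ring.
Qed.

Lemma has_symmetry_C2_2 al be ga a b :
  has_symmetry (htensor al be ga 0 0 a b 0 0).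
Proof.
have oP : SO3 (mx3 (-1) 0 0 0 1 0 0 0 (-1)) by apply: SO3_mx3; ring.
exists (mx3 (-1) 0 0 0 1 0 0 0 (-1)) => //; split.
  by move/matrixP/(_ x1 x1); rewrite !mxE /=; lra.
apply: htensor_fix; first by case: oP.
all: rewrite act4_slots /slot1 /slot2 /slot3 /slot4 !mx3_row /htensor /occ /=; ring.
Qed.

Lemma has_symmetry_C2_3 al be ga de ep :
  has_symmetry (htensor al be ga de ep 0 0 0 0).
Proof.
have oP : SO3 (mx3 (-1) 0 0 0 (-1) 0 0 0 1) by apply: SO3_mx3; ring.
exists (mx3 (-1) 0 0 0 (-1) 0 0 0 1) => //; split.
  by move/matrixP/(_ x1 x1); rewrite !mxE /=; lra.
apply: htensor_fix; first by case: oP.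
all: rewrite act4_slots /slot1 /slot2 /slot3 /slot4 !mx3_row /htensor /occ /=; ring.
Qed.

Lemma sin_C3 : exists s : R, s ^+ 2 = 3 / 4.
Proof. by exists (Num.sqrt (3 / 4)); rewrite sqr_sqrtr //; lra. Qed.

(** Eliminates the higher powers of [s] from monomials in which a tensor parameter [z] occurs
    linearly, so that invariance under a third of a turn becomes a goal for [lra]. *)
Lemma sin_C3_pow (s z : R) : s ^+ 2 = 3 / 4 ->
  [/\ z * s ^+ 2 = 3 / 4 * z, z * s ^+ 3 = 3 / 4 * (z * s)
    & z * s ^+ 4 = 9 / 16 * z].
Proof.
move=> s2; split; first by rewrite s2 mulrC.
  by rewrite exprS s2; lra.
by rewrite (exprM s 2 2) s2; lra.
Qed.

(** With [z = x + i y] on the horizontal plane, the quartic form restricts to [3 be |z|^4] and [f]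
    is [a Re z^3 + c Im z^3]; both are invariant under a third of a turn. *)
Lemma has_symmetry_C3_3 (be a c : R) :
  has_symmetry (htensor (3 * be) be (3 * be) 0 0 a (- a) c (- c)).
Proof.
have [s s2] := sin_C3.
have [be2 be3 be4] := sin_C3_pow be s2.
have [a2 a3 a4] := sin_C3_pow a s2.
have [c2 c3 c4] := sin_C3_pow c s2.
have oP : SO3 (mx3 (- 2^-1) s 0 (- s) (- 2^-1) 0 0 0 1) by apply: SO3_mx3; lra.
exists (mx3 (- 2^-1) s 0 (- s) (- 2^-1) 0 0 0 1) => //; split.
  by move/matrixP/(_ x1 x1); rewrite !mxE /=; lra.
apply: htensor_fix; first by case: oP.
all: rewrite act4_slots /slot1 /slot2 /slot3 /slot4 !mx3_row /htensor /occ /=.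
all: lra.
Qed.

(** The same shape about the second axis: [H1111], [H1133], [H3333] are in proportion 3 : 1 : 3, and
    the entries with exactly one index 2 form a harmonic binary cubic in the other two
    coordinates. *)
Lemma has_symmetry_C3_2 (be de c : R) :
  has_symmetry (htensor (- (3 / 4) * be) be (- 2 * be) de 0 0 0 c 0).
Proof.
have [s s2] := sin_C3.
have [be2 be3 be4] := sin_C3_pow be s2.
have [de2 de3 de4] := sin_C3_pow de s2.
have [c2 c3 c4] := sin_C3_pow c s2.
have oP : SO3 (mx3 (- 2^-1) 0 s 0 1 0 (- s) 0 (- 2^-1)) by apply: SO3_mx3; lra.
exists (mx3 (- 2^-1) 0 s 0 1 0 (- s) 0 (- 2^-1)) => //; split.
  by move/matrixP/(_ x1 x1); rewrite !mxE /=; lra.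
apply: htensor_fix; first by case: oP.
all: rewrite act4_slots /slot1 /slot2 /slot3 /slot4 !mx3_row /htensor /occ /=.
all: lra.
Qed.

Lemma has_symmetry_C3_1 (be ep b : R) :
  has_symmetry (htensor (- 2 * be) be (- (3 / 4) * be) 0 ep 0 b 0 0).
Proof.
have [s s2] := sin_C3.
have [be2 be3 be4] := sin_C3_pow be s2.
have [ep2 ep3 ep4] := sin_C3_pow ep s2.
have [b2 b3 b4] := sin_C3_pow b s2.
have oP : SO3 (mx3 1 0 0 0 (- 2^-1) s 0 (- s) (- 2^-1)) by apply: SO3_mx3; lra.
exists (mx3 1 0 0 0 (- 2^-1) s 0 (- s) (- 2^-1)) => //; split.
  by move/matrixP/(_ x2 x2); rewrite !mxE /=; lra.
apply: htensor_fix; first by case: oP.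
all: rewrite act4_slots /slot1 /slot2 /slot3 /slot4 !mx3_row /htensor /occ /=.
all: lra.
Qed.

End Coordinates.

(** * Case analysis when [d2] is not scalar *)

Section Eigentensor.
Variable R : realFieldType.

(* The tensor has eigentensors [diag (2u - v, 2v - u, - u - v)] (which is three
   times the deviator of [d2]) and, up to off-diagonal terms,
   [w = diag (v, - u, u - v)]; the diagonals of [H12..], [H13..], [H23..] are
   [r w], [s w], [t w]. The next three relations are the vanishing of the
   off-diagonal entries of [d2], and the last one is [u = d11 - d33]. *)
Lemma no_oblique_eigentensor (l m u v r s t al be ga : R) :
  al = l * (2 * u - v) ^+ 2 + m * v ^+ 2 ->
  ga = l * (2 * v - u) ^+ 2 + m * u ^+ 2 ->
  be = l * (2 * u - v) * (2 * v - u) - m * u * v ->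
  u != 0 -> v != 0 -> u - v != 0 -> r != 0 -> s != 0 -> t != 0 ->
  s * ((2 * be + ga) * v + (2 * al + be - 4 * ga) * u) = 4 * t * r * u ^+ 2 ->
  t * ((2 * be + al) * u + (2 * ga + be - 4 * al) * v) = - 4 * s * r * v ^+ 2 ->
  r * (al * v - ga * u + 3 * (v - u) * (al + 3 * be + ga))
    + 4 * s * t * (u - v) ^+ 2 = 0 ->
  u = al ^+ 2 + 3 * be ^+ 2 - 3 * (be + ga) ^+ 2 - (al + 2 * be + ga) ^+ 2
    + t ^+ 2 * (3 * v ^+ 2 - u ^+ 2 - 3 * (v - u) ^+ 2)
    + s ^+ 2 * (2 * v ^+ 2 - 2 * (v - u) ^+ 2)
    + r ^+ 2 * (3 * v ^+ 2 + u ^+ 2 - 3 * (v - u) ^+ 2) ->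
  False.
Proof.
move=> al0 ga0 be0 un vn uvn rn sn tn.
set M1 := (X in s * X = _); set M2 := (X in t * X = _).
set K := (X in r * X + _) => e1 e2 e3 eu.
have {}e3 : r * K = - (4 * s * t * (u - v) ^+ 2).
  by apply/eqP; rewrite -addr_eq0 e3.
(* Multiplying the three relations in pairs determines [r], [s], [t] up to sign. *)
have t2 : 16 * u ^+ 2 * (u - v) ^+ 2 * t ^+ 2 = - M1 * K.
  apply: (mulfI (mulf_neq0 rn sn)).
  transitivity (- (s * M1) * (r * K)); last by ring.
  by rewrite e1 e3; ring.
have s2 : 16 * v ^+ 2 * (u - v) ^+ 2 * s ^+ 2 = M2 * K.
  apply: (mulfI (mulf_neq0 rn tn)).
  transitivity ((t * M2) * (r * K)); last by ring.
  by rewrite e2 e3; ring.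
have r2 : 16 * v ^+ 2 * u ^+ 2 * r ^+ 2 = - M1 * M2.
  apply: (mulfI (mulf_neq0 tn sn)).
  transitivity (- (s * M1) * (t * M2)); last by ring.
  by rewrite e1 e2; ring.
(* The factor clears the denominators of all three squares; after substitution the right-hand side
   is a polynomial in [l], [m], [u], [v] that vanishes identically. *)
have : 16 * u ^+ 2 * v ^+ 2 * (u - v) ^+ 2 * u = 0.
  rewrite {3}eu.
  transitivity (16 * u ^+ 2 * v ^+ 2 * (u - v) ^+ 2
      * (al ^+ 2 + 3 * be ^+ 2 - 3 * (be + ga) ^+ 2 - (al + 2 * be + ga) ^+ 2)
    + (- M1 * K) * v ^+ 2 * (3 * v ^+ 2 - u ^+ 2 - 3 * (v - u) ^+ 2)
    + (M2 * K) * u ^+ 2 * (2 * v ^+ 2 - 2 * (v - u) ^+ 2)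
    + (- M1 * M2) * (u - v) ^+ 2 * (3 * v ^+ 2 + u ^+ 2 - 3 * (v - u) ^+ 2)).
    by rewrite -t2 -s2 -r2; ring.
  by rewrite /M1 /M2 /K al0 be0 ga0; ring.
move/eqP; rewrite !mulf_eq0 ?expf_eq0 /= (negPf un) (negPf vn) (negPf uvn).
by rewrite pnatr_eq0.
Qed.
End Eigentensor.

Section CaseAnalysis.
Variable R : realType.
Implicit Types (T : tensor4 R) (g P : 'M[R]_3).

Lemma sqrD_gt0 (x y : R) : (x != 0) || (y != 0) -> 0 < x ^+ 2 + y ^+ 2.
Proof.
move=> xy; rewrite lt0r addr_ge0 ?sqr_ge0 // andbT.
by rewrite paddr_eq0 ?sqr_ge0 // !sqrf_eq0 negb_and.
Qed.

Lemma unit_direction (x y : R) :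
  exists r p q : R, [/\ p ^+ 2 + q ^+ 2 = 1, x = r * p & y = r * q].
Proof.
have [xy|] := boolP ((x != 0) || (y != 0)); last first.
  rewrite negb_or !negbK => /andP[/eqP -> /eqP ->].
  by exists 0, 1, 0; split; ring.
have n0 := sqrD_gt0 xy; set n := x ^+ 2 + y ^+ 2 in n0.
have sn0 : Num.sqrt n != 0 by rewrite sqrtr_eq0 -ltNge.
exists (Num.sqrt n), (x / Num.sqrt n), (y / Num.sqrt n).
split; try by field.
by rewrite !expr_div_n sqr_sqrtr ?ltW // -mulrDl -/n divff // gt_eqF.
Qed.

(** The equation is the vanishing of the off-diagonal entry, after a planar rotation, of a symmetric
    matrix with off-diagonal entry [q] and diagonal difference [p = A22 - A11]. For [q != 0] the
    direction used, [(2 * q, p + z)], is an eigenvector for the larger eigenvalue. *)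
Lemma planar_diagonalization (p q : R) :
  exists s t : R, s ^+ 2 + t ^+ 2 = 1 /\ (s ^+ 2 - t ^+ 2) * q + s * t * p = 0.
Proof.
have [->|q0] := eqVneq q 0.
  by exists 1, 0; split; ring.
pose z := Num.sqrt (p ^+ 2 + 4 * q ^+ 2).
have z2 : z ^+ 2 = p ^+ 2 + 4 * q ^+ 2.
  by rewrite sqr_sqrtr //; have := sqr_ge0 p; have := sqr_ge0 q; lra.
have [r [s [t [st qs pt]]]] := unit_direction (2 * q) (p + z).
have r0 : r != 0.
  by apply: contra_neq q0 => r0; move: qs; rewrite r0 mul0r; lra.
exists s, t; split=> //; apply: (mulfI (expf_neq0 2 r0)).
transitivity (((r * s) ^+ 2 - (r * t) ^+ 2) * q + (r * s) * (r * t) * p); first by ring.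
rewrite -qs -pt mulr0.
transitivity (q * (4 * q ^+ 2 + p ^+ 2 - z ^+ 2)); first by ring.
by rewrite z2; ring.
Qed.

Definition rot3 (s t : R) := mx3 s t 0 (- t) s 0 0 0 1.

Lemma SO3_rot3 s t : s ^+ 2 + t ^+ 2 = 1 -> SO3 (rot3 s t).
Proof. by move=> st; apply: SO3_mx3; lra. Qed.

Lemma act2E P (D : 'M[R]_3) i j :
  act2 P D i j = \sum_(k < 3) P i k * (\sum_(l < 3) P j l * D k l).
Proof.
rewrite /act2 -mulmxA mxE; apply: eq_bigr => k _; rewrite mxE.
by congr (_ * _); apply: eq_bigr => l _; rewrite mxE mulrC.
Qed.

(* The quadratic relation in [u, v] says that [diag (u, v, 0)] is an eigentensor
   modulo the identity. *)
Lemma distinct_eigenvalues_case (al be ga de ep a b c d u v r s t : R) :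
  (a, b) = (s * v, - s * u) -> (c, d) = (t * v, - t * u) ->
  (de, ep) = (r * v, - r * u) ->
  let T := htensor al be ga de ep a b c d in
  d2 T x1 x2 = 0 -> d2 T x1 x3 = 0 -> d2 T x2 x3 = 0 ->
  d2 T x1 x1 - d2 T x3 x3 = u ->
  - (al + 2 * be) * u ^+ 2 + 2 * (al - ga) * u * v + (2 * be + ga) * v ^+ 2 = 0 ->
  u != 0 -> v != 0 -> u != v -> has_symmetry T.
Proof.
move=> [-> ->] [-> ->] [-> ->] T; rewrite /T d2_12 d2_13 d2_23 d2_11_33.
move=> h12 h13 h23 hu hE u0 v0 uv; rewrite -subr_eq0 in uv.
have e12 : r * (al * v - ga * u + 3 * (v - u) * (al + 3 * be + ga))
    + 4 * s * t * (u - v) ^+ 2 = 0 by rewrite -h12; ring.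
have e13 : s * ((2 * be + ga) * v + (2 * al + be - 4 * ga) * u) =
    4 * t * r * u ^+ 2.
  by apply/eqP; rewrite -subr_eq0; apply/eqP; rewrite -[RHS]oppr0 -h13; ring.
have e23 : t * ((2 * be + al) * u + (2 * ga + be - 4 * al) * v) =
    - 4 * s * r * v ^+ 2.
  by apply/eqP; rewrite -subr_eq0; apply/eqP; rewrite -h23; ring.
have [r0|rn] := eqVneq r 0.
  have : s * t == 0.
    have /eqP : 4 * s * t * (u - v) ^+ 2 = 0 by rewrite -e12 r0; ring.
    by rewrite !mulf_eq0 ?expf_eq0 (negPf uv) /= pnatr_eq0 /= ?orbF.
  rewrite mulf_eq0 => /orP[] /eqP z0; rewrite r0 z0 !mul0r oppr0 !mul0r.
    exact: has_symmetry_C2_1.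
  exact: has_symmetry_C2_2.
have [s0|sn] := eqVneq s 0.
  have /eqP : 4 * t * r * u ^+ 2 = 0 by rewrite -e13 s0 mul0r.
  rewrite !mulf_eq0 ?expf_eq0 (negPf u0) (negPf rn) /= pnatr_eq0 /= ?orbF => /eqP t0.
  rewrite s0 t0 !oppr0 !mul0r; exact: has_symmetry_C2_3.
have [t0|tn] := eqVneq t 0.
  have /eqP : - 4 * s * r * v ^+ 2 = 0 by rewrite -e23 t0 mul0r.
  by rewrite !mulf_eq0 ?expf_eq0 oppr_eq0 (negPf v0) (negPf rn) (negPf sn) /= pnatr_eq0.
exfalso.
pose q := u ^+ 2 - u * v + v ^+ 2.
have q0 : q != 0.
  rewrite gt_eqF // /q; have := sqrD_gt0 (x := u - v / 2) (y := v).
  by rewrite v0 orbT => /(_ isT); nra.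
(* The block of entries [H_iijj] is expanded in the orthogonal vectors [(2u - v, 2v - u, - u - v)]
   and [(v, - u, u - v)], of squared lengths [6 * q] and [2 * q]. The diagonal coefficients are [l]
   and [m]; the mixed one is [E / (4 * q ^+ 2)], which is zero. *)
pose l := (al * u ^+ 2 + 2 * be * u * v + ga * v ^+ 2) / (4 * q ^+ 2).
pose m := (al * (2 * v - u) ^+ 2 + 2 * be * (2 * v - u) * (v - 2 * u)
           + ga * (v - 2 * u) ^+ 2) / (4 * q ^+ 2).
move: hE; set E := (X in X = 0 -> _) => E0.
apply: (@no_oblique_eigentensor _ l m u v r s t al be ga) => //.
- transitivity (l * (2 * u - v) ^+ 2 + m * v ^+ 2
    + 2 * (2 * u - v) * v * E / (4 * q ^+ 2)).
    by rewrite /l /m /E /q; field.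
  by rewrite E0 mulr0 mul0r addr0.
- transitivity (l * (2 * v - u) ^+ 2 + m * u ^+ 2
    - 2 * (2 * v - u) * u * E / (4 * q ^+ 2)).
    by rewrite /l /m /E /q; field.
  by rewrite E0 mulr0 mul0r subr0.
- transitivity (l * (2 * u - v) * (2 * v - u) - m * u * v
    + ((2 * v - u) * v - (2 * u - v) * u) * E / (4 * q ^+ 2)).
    by rewrite /l /m /E /q; field.
  by rewrite E0 mulr0 mul0r addr0.
- by rewrite -{1}hu; ring.
Qed.

Lemma cube_normal_form T : is_harmonic T ->
  T x1 x2 x2 x3 = 0 -> T x1 x1 x2 x3 = 0 -> T x2 x2 x2 x3 = 0 ->
  d2 T x1 x3 = 0 -> d2 T x2 x3 = 0 -> d2 T x1 x1 = d2 T x3 x3 ->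
  has_symmetry T.
Proof.
move=> hT b0 c0 d0; rewrite (harmonic_eq hT) b0 c0 d0.
move: (T x1 x1 x1 x1) (T x1 x1 x2 x2) (T x2 x2 x2 x2) (T x1 x1 x1 x2)
  (T x1 x2 x2 x2) (T x1 x1 x1 x3) => al be ga de ep a {T hT b0 c0 d0}.
rewrite d2_13 d2_23 => h13 h23 /eqP; rewrite -subr_eq0 d2_11_33 => /eqP hu.
have [->|a0] := eqVneq a 0; first exact: has_symmetry_C2_3.
have gaE : ga = - 2 * be.
  apply: (mulIf a0); apply/eqP; rewrite -subr_eq0; apply/eqP.
  by rewrite -[RHS]oppr0 -h13; ring.
have epE : ep = - (4 / 3) * de.
  apply: (mulIf a0); apply/eqP; rewrite -subr_eq0; apply/eqP.
  have: (3 * ep + 4 * de) * a = 0 by rewrite -h23; ring.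
  lra.
(* After substitution everything in [d11 - d33] cancels except a positive multiple of [de ^+ 2]. *)
have de0 : de = 0.
  apply/eqP; rewrite -sqrf_eq0; apply/eqP.
  by move: hu; rewrite gaE epE; lra.
by rewrite epE de0 mulr0; apply: has_symmetry_C2_2.
Qed.

(** The last relation says that [(s, t)] is isotropic for [diag (u, v)], which makes [f] a multiple
    of the cube of [s x1 + t x2]. Rotating this direction to the first axis leaves only [H1113] in
    [f] and gives [d11 = d33]. *)
Lemma cube_case (al be ga de ep a b c d s t u v : R) :
  (a, b) = (s * v, - s * u) -> (c, d) = (t * v, - t * u) ->
  let T := htensor al be ga de ep a b c d in
  d2 T x1 x2 = 0 -> d2 T x1 x3 = 0 -> d2 T x2 x3 = 0 ->
  d2 T x1 x1 - d2 T x3 x3 = u -> d2 T x2 x2 - d2 T x3 x3 = v ->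
  s ^+ 2 * u + t ^+ 2 * v = 0 -> has_symmetry T.
Proof.
move=> eab ecd T h12 h13 h23 hu hv; have hT := htensor_harmonic al be ga de ep a b c d.
have [r [p [q [pq sE tE]]]] := unit_direction s t.
move: eab ecd; rewrite sE tE => -[aE bE] [cE dE].
have [r0|r0] := eqVneq r 0 => nul.
  rewrite /T aE bE cE dE r0 !(mul0r, oppr0); exact: has_symmetry_C2_3.
have {}nul : p ^+ 2 * u + q ^+ 2 * v = 0.
  apply: (mulfI (expf_neq0 2 r0)); rewrite mulr0 -nul; ring.
have oP := SO3_rot3 pq; apply: (has_symmetry_act oP).
have dsym i j : d2 T j i = d2 T i j by rewrite -{2}(d2_sym hT) [RHS]mxE.
have h21 := dsym x1 x2. have h31 := dsym x1 x3. have h32 := dsym x2 x3.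
rewrite h12 h13 h23 in h21 h31 h32.
case: (oP) => PP _; apply: cube_normal_form; first exact: act4_harmonic.
- rewrite act4_slots /slot1 /slot2 /slot3 /slot4 !mx3_row /T /htensor /occ /=.
  rewrite aE bE cE dE.
  transitivity (- r * (p ^+ 2 - q ^+ 2) * (p ^+ 2 * u + q ^+ 2 * v));
    last by rewrite nul mulr0.
  ring.
- rewrite act4_slots /slot1 /slot2 /slot3 /slot4 !mx3_row /T /htensor /occ /=.
  rewrite aE bE cE dE.
  transitivity (- 2 * r * p * q * (p ^+ 2 * u + q ^+ 2 * v));
    last by rewrite nul mulr0.
  ring.
- rewrite act4_slots /slot1 /slot2 /slot3 /slot4 !mx3_row /T /htensor /occ /=.
  rewrite aE bE cE dE.
  transitivity (2 * r * p * q * (p ^+ 2 * u + q ^+ 2 * v));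
    last by rewrite nul mulr0.
  ring.
- by rewrite d2_act // act2E !mx3_row h13 h23 h31 h32; ring.
- by rewrite d2_act // act2E !mx3_row h13 h23 h31 h32; ring.
- rewrite d2_act // !act2E !mx3_row h12 h13 h23 h21 h31 h32.
  have : d2 T x3 x3 * (p ^+ 2 + q ^+ 2) = d2 T x3 x3 by rewrite pq mulr1.
  by move: nul; rewrite -hu -hv; lra.
Qed.

Lemma nonscalar_case T : is_harmonic T ->
  d2 T x1 x2 = 0 -> d2 T x1 x3 = 0 -> d2 T x2 x3 = 0 ->
  c3 T x1 x3 = 0 -> c3 T x2 x3 = 0 -> c4 T x1 x3 = 0 -> c4 T x2 x3 = 0 ->
  (d2 T x1 x1 != d2 T x3 x3) || (d2 T x2 x2 != d2 T x3 x3) -> has_symmetry T.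
Proof.
move=> hT.
have dsym i j : d2 T j i = d2 T i j by rewrite -{2}(d2_sym hT) [RHS]mxE.
have csym i j : c3 T j i = c3 T i j.
  by rewrite -{2}(ddot42_sym (d2 T) hT : (c3 T)^T = c3 T) [RHS]mxE.
move: (hT) dsym csym; rewrite (harmonic_eq hT).
move: (T x1 x1 x1 x1) (T x1 x1 x2 x2) (T x2 x2 x2 x2) (T x1 x1 x1 x2)
  (T x1 x2 x2 x2) (T x1 x1 x1 x3) (T x1 x2 x2 x3) (T x1 x1 x2 x3)
  (T x2 x2 x2 x3) => al be ga de ep a b c d {T hT}.
set T := htensor _ _ _ _ _ _ _ _ _ => hT dsym csym h12 h13 h23 k13 k23 l13 l23.
have h21 := dsym x1 x2. have h31 := dsym x1 x3. have h32 := dsym x2 x3.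
rewrite h13 in h31. rewrite h23 in h32.
have k21 := csym x1 x2. have k31 := csym x1 x3. have k32 := csym x2 x3.
rewrite k13 in k31. rewrite k23 in k32.
move: l13 l23; rewrite /c4 /T ddot42_13 // ddot42_23 // -/T.
rewrite /c3 /T ddot42_11_33 // ddot42_22_33 // ddot42_12 // -/T h12 !mulr0 !mul0r !addr0.
move: (k13) (k23); rewrite /c3 /T ddot42_13 // ddot42_23 // -/T h12 mulr0 !mul0r !addr0.
rewrite -[d2 T x1 x1 == _]subr_eq0 -[d2 T x2 x2 == _]subr_eq0.
set u := d2 T x1 x1 - _; set v := d2 T x2 x2 - _.
have [uE vE] : u = d2 T x1 x1 - d2 T x3 x3 /\ v = d2 T x2 x2 - d2 T x3 x3 by [].
move: u v uE vE => u v uE vE e1 e2 e3 e4 uv.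
have n0 := sqrD_gt0 uv; have nn : u ^+ 2 + v ^+ 2 != 0 by rewrite gt_eqF.
(* By [e1] and [e2], the pairs [(a, b)] and [(c, d)] are orthogonal to [(u, v)]; [s] and [t] are
   their coefficients along [(v, - u)]. *)
pose s := (a * v - b * u) / (u ^+ 2 + v ^+ 2).
pose t := (c * v - d * u) / (u ^+ 2 + v ^+ 2).
have aE : a = s * v.
  transitivity (s * v + u * (u * a + v * b) / (u ^+ 2 + v ^+ 2));
    last by rewrite e1 mulr0 mul0r addr0.
  by rewrite /s; field.
have bE : b = - s * u.
  transitivity (- s * u + v * (u * a + v * b) / (u ^+ 2 + v ^+ 2));
    last by rewrite e1 mulr0 mul0r addr0.
  by rewrite /s; field.
have cE : c = t * v.
  transitivity (t * v + u * (u * c + v * d) / (u ^+ 2 + v ^+ 2));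
    last by rewrite e2 mulr0 mul0r addr0.
  by rewrite /t; field.
have dE : d = - t * u.
  transitivity (- t * u + v * (u * c + v * d) / (u ^+ 2 + v ^+ 2));
    last by rewrite e2 mulr0 mul0r addr0.
  by rewrite /t; field.
have eab : (a, b) = (s * v, - s * u) by rewrite -aE -bE.
have ecd : (c, d) = (t * v, - t * u) by rewrite -cE -dE.
have [nul|nul] := eqVneq (s ^+ 2 * u + t ^+ 2 * v) 0.
  exact: (cube_case (s := s) (t := t) (u := u) (v := v)).
(* Two combinations of [e3] and [e4] have the nonzero factor [s ^+ 2 * u + t ^+ 2 * v]. They show
   that [c3] has zero entry 12 and, next, that its reduced diagonal is parallel to [(u, v)]. *)
have y0 : u * de + v * ep = 0.
  apply: (mulfI nul); rewrite mulr0.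
  apply: (mulfI (_ : 2 != 0)); first by rewrite pnatr_eq0.
  transitivity (t * ((u * (2 * al + be) + v * (2 * be + ga)) * a +
     (u * (al + 2 * be) + v * (be + 2 * ga)) * b + 2 * (u * de + v * ep) * c)
   - s * ((u * (2 * al + be) + v * (2 * be + ga)) * c +
     (u * (al + 2 * be) + v * (be + 2 * ga)) * d + 2 * (u * de + v * ep) * b)).
    by rewrite aE bE cE dE; ring.
  by rewrite e3 e4 !mulr0 subr0.
have E0 : - (al + 2 * be) * u ^+ 2 + 2 * (al - ga) * u * v + (2 * be + ga) * v ^+ 2 = 0.
  apply: (mulfI nul); rewrite mulr0.
  transitivity (s * u * ((u * (2 * al + be) + v * (2 * be + ga)) * a +
     (u * (al + 2 * be) + v * (be + 2 * ga)) * b + 2 * (u * de + v * ep) * c)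
   + t * v * ((u * (2 * al + be) + v * (2 * be + ga)) * c +
     (u * (al + 2 * be) + v * (be + 2 * ga)) * d + 2 * (u * de + v * ep) * b)).
    by rewrite aE bE cE dE; ring.
  by rewrite e3 e4 !mulr0 addr0.
have [u0|u0] := eqVneq u 0.
  rewrite u0 eqxx /= in uv; rewrite u0 in y0 E0 nul bE dE.
  have ep0 : ep = 0 by apply: (mulfI uv); rewrite mulr0 -y0; ring.
  have gaE : ga = - 2 * be.
    apply: (mulfI (expf_neq0 2 uv)); move: E0; lra.
  have t0 : t != 0 by apply: contra_neq nul => ->; ring.
  move: h12 h23; rewrite /T d2_12 d2_23 aE bE cE dE ep0 gaE => h12 h23.
  have e5 : t * (4 * al + 3 * be) = 4 * s * de.
    by apply: (mulfI uv); move: h23; lra.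
  have e6 : de * (4 * al + 3 * be) = - 4 * s * t * v ^+ 2 by move: h12; lra.
  (* Eliminating [4 * al + 3 * be] between [e5] and [e6] leaves [s] times a positive sum of
     squares. *)
  have s0 : s = 0.
    have : s * (de ^+ 2 + (t * v) ^+ 2) = 0.
      transitivity ((de * (4 * s * de) - t * (- 4 * s * t * v ^+ 2)) / 4); first by field.
      by rewrite -e5 -e6; field.
    move/eqP; rewrite mulf_eq0 => /orP[/eqP //|].
    by rewrite gt_eqF // sqrD_gt0 // mulf_neq0 // orbT.
  have alE : al = - (3 / 4) * be.
    by apply: (mulfI t0); move: e5; rewrite s0; lra.
  by rewrite s0 alE !(mul0r, mulr0, oppr0); apply: has_symmetry_C3_2.
have [v0|v0] := eqVneq v 0.
  rewrite v0 in y0 E0 nul aE cE.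
  have de0 : de = 0 by apply: (mulfI u0); rewrite mulr0 -y0; ring.
  have alE : al = - 2 * be.
    apply: (mulfI (expf_neq0 2 u0)); move: E0; lra.
  have s0 : s != 0 by apply: contra_neq nul => ->; ring.
  move: h12 h13; rewrite /T d2_12 d2_13 aE bE cE dE de0 alE => h12 h13.
  have e5 : s * (4 * ga + 3 * be) = 4 * t * ep.
    by apply: (mulfI u0); move: h13; lra.
  have e6 : ep * (4 * ga + 3 * be) = - 4 * t * s * u ^+ 2 by move: h12; lra.
  have t0 : t = 0.
    have : t * (ep ^+ 2 + (s * u) ^+ 2) = 0.
      transitivity ((ep * (4 * t * ep) - s * (- 4 * t * s * u ^+ 2)) / 4); first by field.
      by rewrite -e5 -e6; field.
    move/eqP; rewrite mulf_eq0 => /orP[/eqP //|].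
    by rewrite gt_eqF // sqrD_gt0 // mulf_neq0 // orbT.
  have gaE : ga = - (3 / 4) * be.
    by apply: (mulfI s0); move: e5; rewrite t0; lra.
  by rewrite t0 gaE !(mul0r, mulr0, oppr0); apply: has_symmetry_C3_1.
have deE : (de, ep) = (de / v * v, - (de / v) * u).
  congr (_, _); first by field.
  by apply: (mulfI v0); move/eqP: y0; rewrite addrC addr_eq0 => /eqP ->; field.
have [euv|uvn] := eqVneq u v; last by apply: (distinct_eigenvalues_case eab ecd deE) => //; symmetry.
have epE : ep = - de by case: deE => _ ->; rewrite euv; field.
have gaE : ga = al.
  by apply: (mulfI (expf_neq0 2 v0)); move: E0; rewrite euv; lra.
move: h13 h23; rewrite /T d2_13 d2_23 aE bE cE dE euv epE gaE => h13 h23.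
have e5 : s * (3 * be - al) = 4 * t * de by apply: (mulfI v0); move: h13; lra.
have e6 : t * (3 * be - al) = - 4 * s * de by apply: (mulfI v0); move: h23; lra.
have st0 : s ^+ 2 + t ^+ 2 != 0.
  by apply: contra_neq nul => st; rewrite euv -mulrDl st mul0r.
(* [e5] and [e6] form a linear system in [3 * be - al] and [de] with determinant
   [4 * (s ^+ 2 + t ^+ 2)]. *)
have alE : al = 3 * be.
  apply/eqP; rewrite eq_sym -subr_eq0; apply/eqP; apply: (mulfI st0); rewrite mulr0.
  transitivity (s * (s * (3 * be - al)) + t * (t * (3 * be - al))); first by ring.
  by rewrite e5 e6; ring.
have de0 : de = 0.
  apply: (mulfI st0); rewrite mulr0.
  transitivity ((t * (4 * t * de) - s * (- 4 * s * de)) / 4); first by field.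
  by rewrite -e5 -e6; field.
by rewrite alE de0 oppr0 !mulNr; apply: has_symmetry_C3_3.
Qed.
End CaseAnalysis.

(** * The case of scalar [d2] *)

Section Scalar.
Variable R : realType.
Implicit Types (T : tensor4 R) (g P : 'M[R]_3) (x n : 'rV[R]_3).

Lemma frame_along n :
  exists P k, SO3 P /\ n = k *: row x3 P.
Proof.
have [r [p [q [pq xE yE]]]] := unit_direction (n 0 x1) (n 0 x2).
have [k [s [t [st rE zE]]]] := unit_direction r (n 0 x3).
(* The rows are the unit vectors of spherical coordinates: polar, azimuthal and radial. *)
exists (mx3 (t * p) (t * q) (- s) (- q) p 0 (s * p) (s * q) t), k; split.
  have e (z : R) : z * (s ^+ 2 + t ^+ 2) = z by rewrite st mulr1.
  have e' (z : R) : z * (p ^+ 2 + q ^+ 2) = z by rewrite pq mulr1.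
  apply: SO3_mx3.
  - by have := e (p ^+ 2); lra.
  - by have := e (q ^+ 2); lra.
  - by rewrite -st; ring.
  - by have := e (p * q); lra.
  - by ring.
  - by ring.
  - by have := e' (s ^+ 2); have := e' (t ^+ 2); lra.
apply/rowP; apply: ord3P; rewrite !mxE /=.
- by rewrite xE rE; ring.
- by rewrite yE rE; ring.
- exact: zE.
Qed.

(** The three vanishing entries make [f] harmonic and give [ep = - de]. If [f = 0] there is a
    half-turn about the third axis; otherwise [d2] scalar forces [al = ga] and the threefold normal
    form. *)
Lemma scalar_case_critical T (lam : R) : is_harmonic T -> d2 T = lam%:M ->
  T x1 x3 x3 x3 = 0 -> T x2 x3 x3 x3 = 0 -> T x1 x2 x3 x3 = 0 ->
  has_symmetry T.
Proof.
move=> hT; rewrite (harmonic_eq hT).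
move: (T x1 x1 x1 x1) (T x1 x1 x2 x2) (T x2 x2 x2 x2) (T x1 x1 x1 x2)
  (T x1 x2 x2 x2) (T x1 x1 x1 x3) (T x1 x2 x2 x3) (T x1 x1 x2 x3)
  (T x2 x2 x2 x3) => al be ga de ep a b c d {T hT}.
set T := htensor _ _ _ _ _ _ _ _ _ => dT.
have h12 : d2 T x1 x2 = 0 by rewrite dT mxE.
have h13 : d2 T x1 x3 = 0 by rewrite dT mxE.
have h23 : d2 T x2 x3 = 0 by rewrite dT mxE.
have hu : d2 T x1 x1 - d2 T x3 x3 = 0 by rewrite dT !mxE subrr.
have hv : d2 T x2 x2 - d2 T x3 x3 = 0 by rewrite dT !mxE subrr.
move: h12 h13 h23 hu hv; rewrite /T d2_12 d2_13 d2_23 d2_11_33 d2_22_33.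
rewrite /htensor /occ /= => h12 h13 h23 hu hv hb hd hep.
have bE : b = - a by lra.
have dE : d = - c by lra.
have epE : ep = - de by lra.
move: h12 h13 h23 hu hv; rewrite bE dE epE => h12 h13 h23 hu hv.
have [ac|] := boolP ((a != 0) || (c != 0)); last first.
  rewrite negb_or !negbK => /andP[/eqP -> /eqP ->]; rewrite oppr0.
  exact: has_symmetry_C2_3.
have n0 := sqrD_gt0 ac; have nn : a ^+ 2 + c ^+ 2 != 0 by rewrite gt_eqF.
have e12 : de * (al - ga) = 0 by move: h12; lra.
have e13 : a * (2 * al + 3 * be - 3 * ga) = 4 * de * c by move: h13; lra.
have e23 : c * (3 * be + 2 * ga - 3 * al) = - 4 * de * a by move: h23; lra.
have euv : (al - ga) * (4 * al + 6 * be + 4 * ga) = 0 by move: hu hv; lra.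
have [ea|na] := eqVneq al ga.
  have alE : al = 3 * be.
    apply/eqP; rewrite eq_sym -subr_eq0; apply/eqP; apply: (mulfI nn); rewrite mulr0.
    transitivity (a * (a * (3 * be - al)) + c * (c * (3 * be - al))); first by ring.
    transitivity (a * (4 * de * c) + c * (- 4 * de * a)); last by ring.
    rewrite -e13 -e23 ea; ring.
  have de0 : de = 0.
    apply: (mulfI nn); rewrite mulr0.
    transitivity ((c * (4 * de * c) - a * (- 4 * de * a)) / 4); first by field.
    by rewrite -e13 -e23 -ea alE; field.
  by rewrite -ea alE de0 oppr0; apply: has_symmetry_C3_3.
(* For [al != ga], either [a = al = 0] or [c = ga = 0] must hold, and then [d11 - d33] is a positive
   definite sum of squares of the remaining parameters. *)
exfalso; rewrite -subr_eq0 in na.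
have de0 : de = 0 by apply: (mulIf na); rewrite mul0r.
have beE : be = - (2 / 3) * (al + ga).
  by have := mulfI na (etrans euv (esym (mulr0 _))); lra.
move: e13 e23 hu; rewrite de0 beE => e13 e23 hu.
have {}e13 : a * ga = 0 by move: e13; lra.
have {}e23 : c * al = 0 by move: e23; lra.
move/eqP: e13; rewrite mulf_eq0 => /orP[] /eqP z;
  move/eqP: e23; rewrite mulf_eq0 => /orP[] /eqP z'.
- by move: ac; rewrite z z' eqxx.
- move: hu n0; rewrite z z'; have := sqr_ge0 ga; lra.
- move: hu n0; rewrite z z'; have := sqr_ge0 al; lra.
- by move: na; rewrite z z' subrr eqxx.
Qed.

(** The first-order condition at a maximum, by evaluation at the single point [z = A / K]: there the
    polynomial is [z ^+ 2 * (4 * K + B + z * C + z ^+ 2 * D)], with [K] dominating the other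
    terms. *)
Lemma quartic_first_order (A B C D : R) :
  (forall e : R, 4 * e * A + e ^+ 2 * B + e ^+ 3 * C + e ^+ 4 * D <= 0) -> A = 0.
Proof.
move=> H; apply: contrapT => /eqP A0.
have A2 : 0 < A ^+ 2 by rewrite exprn_even_gt0.
pose K := 1 + `|A| + `|B| + `|C| + `|D|.
have [[[a0 b0] c0] d0] := (normr_ge0 A, normr_ge0 B, normr_ge0 C, normr_ge0 D).
have K0 : 0 < K by rewrite /K; lra.
pose z := A / K; have zA : A = K * z by rewrite /z mulrC divfK // gt_eqF.
have z1 : `|z| <= 1.
  by rewrite normrM normfV (gtr0_norm K0) ler_pdivrMr // mul1r /K; lra.
have z2 : z ^+ 2 <= 1 by rewrite -real_normK ?num_real // exprn_ile1.
have z20 : 0 < z ^+ 2 by rewrite exprn_even_gt0 //= /z mulf_neq0 // invr_eq0 gt_eqF.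
have hB : - `|B| <= B by rewrite lerNl ler_normr lexx orbT.
have hC : - `|C| <= z * C.
  rewrite lerNl (le_trans (ler_norm _)) // normrN normrM.
  by rewrite ler_piMl.
have hD : - `|D| <= z ^+ 2 * D.
  rewrite lerNl (le_trans (ler_norm _)) // normrN normrM.
  by rewrite ler_piMl // ger0_norm // ltW.
have := H z; rewrite {1}zA.
have -> : 4 * z * (K * z) + z ^+ 2 * B + z ^+ 3 * C + z ^+ 4 * D =
  z ^+ 2 * (4 * K + B + z * C + z ^+ 2 * D) by ring.
by rewrite pmulr_rle0 // /K; lra.
Qed.

(** This is [T(x, x, x, x)]: every row of the matrix is [x], so that [act4M] yields the behaviour
    under a change of frame. *)
Definition quartic T x : R := act4 (\matrix_(i, j) x 0 j) T x1 x1 x1 x1.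

Lemma quartic_act P T x : quartic (act4 P T) x = quartic T (x *m P).
Proof.
rewrite /quartic act4M; congr (act4 _ T _ _ _ _).
apply/matrixP => i j; rewrite !mxE; apply: eq_bigr => k _; rewrite !mxE.
by congr (_ * _).
Qed.

Lemma quarticZ T k x : quartic T (k *: x) = k ^+ 4 * quartic T x.
Proof.
rewrite /quartic /act4; do 4 (rewrite mulr_sumr; apply: eq_bigr => ? _).
by rewrite !mxE; ring.
Qed.

Definition sqnorm x : R := \sum_(i < 3) x 0 i ^+ 2.

Lemma sqnorm_act P x : SO3 P -> sqnorm (x *m P) = sqnorm x.
Proof.
move=> oP; have [_ PP] := SO3_trmx oP.
have E y : sqnorm y = (y *m y^T) 0 0.
  by rewrite mxE; apply: eq_bigr => i _; rewrite mxE expr2.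
by rewrite !E trmx_mul mulmxA -(mulmxA x) PP mulmx1.
Qed.

Lemma sqnormZ k x : sqnorm (k *: x) = k ^+ 2 * sqnorm x.
Proof. by rewrite /sqnorm mulr_sumr; apply: eq_bigr => i _; rewrite mxE exprMn. Qed.

Local Open Scope classical_set_scope.
Import numFieldNormedType.Exports.

Lemma continuous_sum3 (F : 'I_3 -> 'rV[R]_3 -> R) :
  (forall i, continuous (F i)) -> continuous (fun x => \sum_(i < 3) F i x).
Proof.
move=> cF; rewrite (_ : (fun x => _) = F x1 \+ F x2 \+ F x3); last first.
  by apply/funext => x; rewrite sum3.
by move=> x; exact: (cvgD (cvgD (cF x1 x) (cF x2 x)) (cF x3 x)).
Qed.

Lemma quartic_continuous T : continuous (quartic T).
Proof.
have cx (i : 'I_3) : continuous (fun x : 'rV[R]_3 => x 0 i) by apply: coord_continuous.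
rewrite (_ : quartic T = fun x => \sum_(a < 3) \sum_(b < 3) \sum_(c < 3)
   \sum_(d < 3) x 0 a * x 0 b * x 0 c * x 0 d * T a b c d); last first.
  by apply/funext => x; rewrite /quartic /act4; do 4 (apply: eq_bigr => ? _);
    rewrite !mxE.
apply: continuous_sum3 => a; apply: continuous_sum3 => b.
apply: continuous_sum3 => c; apply: continuous_sum3 => d x.
exact: (cvgM (cvgM (cvgM (cvgM (cx a x) (cx b x)) (cx c x)) (cx d x)) (cvg_cst _)).
Qed.

Lemma sqnorm_continuous : continuous sqnorm.
Proof.
apply: continuous_sum3 => i x.
exact: (cvgM (@coord_continuous R 1 3 0 i x) (@coord_continuous R 1 3 0 i x)).
Qed.

Lemma sphere_compact : compact [set x : 'rV[R]_3 | sqnorm x = 1].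
Proof.
have cube : compact [set v : 'rV[R]_3 | forall i, `[(-1), 1]%classic (v ord0 i)].
  exact: (@rV_compact R 3 (fun=> `[(-1), 1]%classic) (fun=> @segment_compact R (-1) 1)).
apply: subclosed_compact cube _.
  apply: (@closed_comp _ _ sqnorm [set x : R | x = 1]); last exact: closed_eq.
  by move=> x _; apply: sqnorm_continuous.
move=> x /= x1 i.
have : x 0 i ^+ 2 <= 1.
  rewrite -x1 /sqnorm (bigD1 i) //= lerDl sumr_ge0 // => j _; exact: sqr_ge0.
by rewrite in_itv /=; move=> h; apply/andP; split; nra.
Qed.

(** Homogeneity extends the bound from the sphere to all vectors, so it can be tested along straight
    lines without normalization. *)
Lemma quartic_max T : exists2 n, sqnorm n = 1 &
  forall x, quartic T x <= quartic T n * sqnorm x ^+ 2.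
Proof.
have [||n] := @EVT_max_rV R 3 (quartic T) [set x | sqnorm x = 1] _ sphere_compact.
- exists (\row_j (j == x1)%:R); rewrite /= /sqnorm sum3 !mxE /=; ring.
- by apply: continuous_subspaceT => x; apply: quartic_continuous.
rewrite inE /= => n1 nmax; exists n => // x.
have [x0|x0] := eqVneq (sqnorm x) 0.
  have -> : x = 0 *: x.
    rewrite scale0r; apply/rowP => i; rewrite mxE; apply/eqP; rewrite -sqrf_eq0.
    move: x0; rewrite /sqnorm => /psumr_eq0P -> //= j _; exact: sqr_ge0.
  by rewrite quarticZ sqnormZ !expr0n /= !mul0r expr0n mulr0.
have xp : 0 < sqnorm x by rewrite lt0r x0 sumr_ge0 // => i _; apply: sqr_ge0.
set r := Num.sqrt (sqnorm x).
have r2 : r ^+ 2 = sqnorm x by rewrite sqr_sqrtr // ltW.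
have r0 : r != 0 by rewrite sqrtr_eq0 -ltNge.
have := nmax (r^-1 *: x); rewrite inE /= sqnormZ exprVn r2 mulVf // => /(_ erefl).
rewrite quarticZ exprVn (exprM r 2 2) r2 mulrC ler_pdivrMr //.
by rewrite exprn_gt0.
Qed.

Lemma quartic_critical_frame T : is_harmonic T ->
  exists2 P, SO3 P & act4 P T x1 x3 x3 x3 = 0 /\ act4 P T x2 x3 x3 x3 = 0.
Proof.
move=> hT; have [n n1 nmax] := quartic_max T.
have [P [k [oP nE]]] := frame_along n; exists P => //.
have hT' := act4_harmonic (proj1 oP) hT.
set T' := act4 P T in hT' *.
have row3 : row x3 P = (\row_j (j == x3)%:R) *m P.
  apply/rowP => j; rewrite !mxE sum3 !mxE /=; ring.
have k1 : k ^+ 2 = 1.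
  move: n1; rewrite nE row3 sqnormZ sqnorm_act // => <-.
  rewrite -[LHS]mulr1; congr (_ * _); rewrite /sqnorm sum3 !mxE /=; ring.
have qE (x : 'rV[R]_3) : quartic T' x =
    act4 (mx3 (x 0 x1) (x 0 x2) (x 0 x3) 0 0 0 0 0 0) T' x1 x1 x1 x1.
  rewrite /quartic /act4; do 4 (apply: eq_bigr => ? _).
  have mE : forall j, (\matrix_(i, j) x 0 j : 'M[R]_3) x1 j =
      mx3 (x 0 x1) (x 0 x2) (x 0 x3) 0 0 0 0 0 0 x1 j.
    by apply: ord3P; rewrite !mxE.
  by rewrite !mE.
have Tn : quartic T n = T' x3 x3 x3 x3.
  rewrite nE quarticZ (exprM k 2 2) k1 expr1n mul1r row3 -quartic_act qE !mxE /=.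
  rewrite act4_slots /slot1 /slot2 /slot3 /slot4 !mx3_row; ring.
have bound (x : 'rV[R]_3) : quartic T' x <= T' x3 x3 x3 x3 * sqnorm x ^+ 2.
  by rewrite quartic_act -Tn -(sqnorm_act x oP).
move: bound qE; rewrite (harmonic_eq hT').
move: (T' x1 x1 x1 x1) (T' x1 x1 x2 x2) (T' x2 x2 x2 x2) (T' x1 x1 x1 x2)
  (T' x1 x2 x2 x2) (T' x1 x1 x1 x3) (T' x1 x2 x2 x3) (T' x1 x1 x2 x3)
  (T' x2 x2 x2 x3) => al be ga de ep a b c d bound qE.
split.
(* The coefficients come from expanding the quartic form minus [H3333 * sqnorm x ^+ 2] along
   [x = e3 + e e1]; the linear one is [4 * H1333]. *)
- apply: (@quartic_first_order _
    (6 * - (al + be) - 2 * (al + 2 * be + ga)) (4 * a) (al - (al + 2 * be + ga))) => e.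
  have := bound (\row_j (if j == x1 then e else (j == x3)%:R)).
  rewrite qE /sqnorm sum3 !mxE /=.
  rewrite act4_slots /slot1 /slot2 /slot3 /slot4 !mx3_row /htensor /occ /=.
  lra.
- apply: (@quartic_first_order _
    (6 * - (be + ga) - 2 * (al + 2 * be + ga)) (4 * d) (ga - (al + 2 * be + ga))) => e.
  have := bound (\row_j (if j == x2 then e else (j == x3)%:R)).
  rewrite qE /sqnorm sum3 !mxE /=.
  rewrite act4_slots /slot1 /slot2 /slot3 /slot4 !mx3_row /htensor /occ /=.
  lra.
Qed.

Lemma scalar_case T (lam : R) : is_harmonic T -> d2 T = lam%:M -> has_symmetry T.
Proof.
move=> hT dT; have [P oP [h1 h2]] := quartic_critical_frame hT.
apply: (has_symmetry_act oP).
have act_scalar Q : SO3 Q -> act2 Q lam%:M = lam%:M.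
  move=> /SO3_trmx[_ QQ].
  by rewrite /act2 mul_mx_scalar -scalemxAl QQ scalemx1.
have dT' : d2 (act4 P T) = lam%:M by rewrite d2_act ?dT ?act_scalar //; case: oP.
have {hT} hT' := act4_harmonic (proj1 oP) hT.
move: (act4 P T) hT' h1 h2 dT' => {T dT oP P} T hT h1 h2 dT.
(* A rotation about the third axis preserves [H1333 = H2333 = 0] and can diagonalize the horizontal
   part of [H_ij33]. *)
have [s [t [st diag]]] :=
  planar_diagonalization (T x2 x2 x3 x3 - T x1 x1 x3 x3) (T x1 x2 x3 x3).
have oQ := SO3_rot3 st; apply: (has_symmetry_act oQ).
case: (hT) => T12 _ _ _.
apply: (@scalar_case_critical _ lam).
- by apply: act4_harmonic => //; case: oQ.
- by rewrite d2_act ?dT ?act_scalar //; case: oQ.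
- rewrite act4_slots /slot1 /slot2 /slot3 /slot4 !mx3_row h1 h2; ring.
- rewrite act4_slots /slot1 /slot2 /slot3 /slot4 !mx3_row h1 h2; ring.
- rewrite act4_slots /slot1 /slot2 /slot3 /slot4 !mx3_row (T12 x1 x2 x3 x3).
  by apply: etrans diag; ring.
Qed.
End Scalar.

(** * Transfer of symmetries *)

Section SymmetryTransfer.
Variable R : realType.
Implicit Types (T : tensor4 R) (g P : 'M[R]_3).

(** Since [g - 1 = g (1 - g^T)], [\det g = 1] and the dimension is odd, [\det (g - 1)] equals its
    own opposite. *)
Lemma rotation_axis g : SO3 g -> exists2 n : 'rV[R]_3, n != 0 & n *m g = n.
Proof.
move=> oG; have [_ ggt] := SO3_trmx oG; case: oG => gg dg.
have : \det (g - 1%:M) = 0.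
  have e : \det (g - 1%:M) = - \det (g - 1%:M).
    rewrite -{1}ggt -[X in X - _]mulmx1 -mulmxBr det_mulmx dg mul1r.
    rewrite -[X in \det X]trmxK det_tr linearB /= trmxK trmx1.
    by rewrite -opprB -scaleN1r detZ; ring.
  by apply/eqP; move: e => /eqP; rewrite -addr_eq0 -mulr2n mulrn_eq0.
move/eqP/det0P => [n n0 nE]; exists n => //.
by apply/eqP; rewrite -subr_eq0 -{2}(mulmx1 n) -mulmxBr nE.
Qed.

(** As [A] commutes with [g], the horizontal vector [(A13, A23)] is fixed by the planar rotation
    induced by [g]; a planar rotation fixing a nonzero vector is the identity. *)
Lemma commute_axis3 g (A : 'M[R]_3) : SO3 g -> g != 1%:M ->
  row x3 g = row x3 1%:M -> sym2 A -> act2 g A = A -> A x1 x3 = 0 /\ A x2 x3 = 0.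
Proof.
move=> oG g1 g3 sA gA; have [_ ggt] := SO3_trmx oG; case: (oG) => gg _.
have r3 j : g x3 j = (x3 == j)%:R by move/rowP: g3 => /(_ j); rewrite !mxE.
have entry (M N : 'M[R]_3) i j : M = N -> M i j = N i j by move->.
have o i j : g i x1 * g j x1 + g i x2 * g j x2 + g i x3 * g j x3 = (i == j)%:R.
  by have := entry _ _ i j ggt; rewrite !mxE sum3 !mxE.
have g13 : g x1 x3 = 0 by have := o x1 x3; rewrite !r3 /=; lra.
have g23 : g x2 x3 = 0 by have := o x2 x3; rewrite !r3 /=; lra.
have o11 := o x1 x1; have o12 := o x1 x2; have o22 := o x2 x2.
rewrite g13 g23 /= in o11 o12 o22.
have dg : g x1 x1 * g x2 x2 - g x1 x2 * g x2 x1 = 1.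
  have gE : g = mx3 (g x1 x1) (g x1 x2) 0 (g x2 x1) (g x2 x2) 0 0 0 1.
    by apply/matrixP; do 2 (apply: ord3P); rewrite ?g13 ?g23 ?r3 [RHS]mxE.
  by have := proj2 oG; rewrite {1}gE det_mx3; lra.
have sA' i j : A j i = A i j by rewrite -{2}sA [RHS]mxE.
have cA : A *m g = g *m A by rewrite -{1}gA /act2 -mulmxA gg mulmx1.
have c31 := entry _ _ x3 x1 cA; have c32 := entry _ _ x3 x2 cA.
rewrite !mxE !sum3 !r3 /= (sA' x1 x3) (sA' x2 x3) in c31 c32.
have [w0|] := boolP ((A x1 x3 != 0) || (A x2 x3 != 0)); last first.
  by rewrite negb_or !negbK => /andP[/eqP -> /eqP ->].
exfalso.
have tr2 : g x1 x1 + g x2 x2 = 2.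
  have det0 : (g x1 x1 - 1) * (g x2 x2 - 1) - g x1 x2 * g x2 x1 = 0.
    case/orP: w0 => w0; apply: (mulfI w0); rewrite mulr0.
      transitivity ((A x1 x3 * (g x1 x1 - 1) + A x2 x3 * g x2 x1) * (g x2 x2 - 1)
        - g x2 x1 * (A x1 x3 * g x1 x2 + A x2 x3 * (g x2 x2 - 1))); first by ring.
      rewrite (_ : A x1 x3 * (g x1 x1 - 1) + _ = 0); last by move: c31; lra.
      rewrite (_ : A x1 x3 * g x1 x2 + _ = 0); last by move: c32; lra.
      by rewrite mul0r mulr0 subr0.
    transitivity ((A x1 x3 * g x1 x2 + A x2 x3 * (g x2 x2 - 1)) * (g x1 x1 - 1)
        - g x1 x2 * (A x1 x3 * (g x1 x1 - 1) + A x2 x3 * g x2 x1)); first by ring.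
    rewrite (_ : A x1 x3 * (g x1 x1 - 1) + _ = 0); last by move: c31; lra.
    rewrite (_ : A x1 x3 * g x1 x2 + _ = 0); last by move: c32; lra.
    by rewrite mul0r mulr0 subr0.
  by move: det0 dg; lra.
have g11 : g x1 x1 = 1 by nra.
have g22 : g x2 x2 = 1 by lra.
have g12 : g x1 x2 = 0.
  by apply/eqP; rewrite -sqrf_eq0; apply/eqP; move: o11; rewrite g11; lra.
have g21 : g x2 x1 = 0.
  by apply/eqP; rewrite -sqrf_eq0; apply/eqP; move: o22; rewrite g22; lra.
move/eqP: g1; apply; apply/matrixP.
by do 2 (apply: ord3P); rewrite ?r3 ?g11 ?g12 ?g13 ?g21 ?g22 ?g23 mxE.
Qed.

(** The symmetry of [T] obtained is not claimed to be [g] itself; the rotation [g] only serves to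
    provide the common axis. *)
Lemma common_symmetry_transfer T g : is_harmonic T -> SO3 g -> g <> 1%:M ->
  act2 g (d2 T) = d2 T -> act2 g (c3 T) = c3 T -> act2 g (c4 T) = c4 T ->
  has_symmetry T.
Proof.
move=> hT oG g1 gd gc3 gc4.
have [n n0 nE] := rotation_axis oG.
have [P [k [oP nP]]] := frame_along n.
have [oPt PPt] := SO3_trmx oP; have PtP := proj1 oP.
have k0 : k != 0 by apply: contra_neq n0 => k0; rewrite nP k0 scale0r.
apply: (has_symmetry_act oP).
pose g' := P *m g *m P^T.
have oG' : SO3 g' by apply: SO3M => //; apply: SO3M.
have g'1 : g' != 1%:M.
  apply/eqP => e; apply: g1; have := congr1 (fun m => P^T *m m *m P) e.
  by rewrite /g' !mulmxA PtP mul1mx -mulmxA PtP !mulmx1 PtP.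
have g'3 : row x3 g' = row x3 1%:M.
  have e : row x3 P *m g = row x3 P.
    by apply: (scalerI k0); rewrite scalemxAl -nP nE.
  by rewrite -PPt !row_mul e.
have fixed (A : 'M[R]_3) : act2 g A = A -> act2 g' (act2 P A) = act2 P A.
  move=> gA; rewrite -{2}gA /act2 /g' !trmx_mul trmxK !mulmxA.
  by rewrite -(mulmxA _ P^T P) PtP mulmx1 -(mulmxA _ P^T P) PtP mulmx1.
have hT' := act4_harmonic PtP hT.
have := fixed _ gd; have := fixed _ gc3; have := fixed _ gc4.
rewrite -d2_act // -c3_act // -c4_act //; clearbody g'.
move: (act4 P T) hT' =>
  {hT gd gc3 gc4 n n0 nE nP k0 fixed oPt PPt PtP oP P T} T hT gc4 gc3 gd.
have [d13 d23] := commute_axis3 oG' g'1 g'3 (d2_sym hT) gd.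
have [c13 c23] := commute_axis3 oG' g'1 g'3 (ddot42_sym _ hT) gc3.
have [e13 e23] := commute_axis3 oG' g'1 g'3 (ddot42_sym _ hT) gc4.
have [s [t [st diag]]] := planar_diagonalization (d2 T x2 x2 - d2 T x1 x1) (d2 T x1 x2).
have oQ := SO3_rot3 st; apply: (has_symmetry_act oQ).
have QQ := proj1 oQ; have hT' := act4_harmonic QQ hT.
have sd i j : d2 T j i = d2 T i j by rewrite -{2}(d2_sym hT) [RHS]mxE.
have rot13 (A : 'M[R]_3) : A x1 x3 = 0 -> A x2 x3 = 0 ->
    act2 (rot3 s t) A x1 x3 = 0 /\ act2 (rot3 s t) A x2 x3 = 0.
  by move=> A13 A23; rewrite !act2E !mx3_row A13 A23; split; ring.
have {d13 d23} [d13 d23] := rot13 _ d13 d23.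
have {c13 c23} [c13 c23] := rot13 _ c13 c23.
have {e13 e23} [e13 e23] := rot13 _ e13 e23.
have d12 : act2 (rot3 s t) (d2 T) x1 x2 = 0.
  by rewrite act2E !mx3_row (sd x1 x2); apply: etrans diag; ring.
rewrite -d2_act // in d12 d13 d23; rewrite -c3_act // in c13 c23.
rewrite -c4_act // in e13 e23.
move: (act4 (rot3 s t) T) hT' d12 d13 d23 c13 c23 e13 e23 =>
  {sd diag gc4 gc3 gd hT T} T hT d12 d13 d23 c13 c23 e13 e23.
have [ns|] := boolP ((d2 T x1 x1 != d2 T x3 x3) || (d2 T x2 x2 != d2 T x3 x3)).
  exact: nonscalar_case.
rewrite negb_or !negbK => /andP[/eqP d1 /eqP d2'].
have sd i j : d2 T j i = d2 T i j by rewrite -{2}(d2_sym hT) [RHS]mxE.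
apply: (@scalar_case _ _ (d2 T x3 x3)) => //.
apply/matrixP; do 2 (apply: ord3P); rewrite ?(sd x1 x2) ?(sd x1 x3) ?(sd x2 x3).
all: by rewrite ?d12 ?d13 ?d23 ?d1 ?d2' [RHS]mxE.
Qed.

(** * Polynomial covariants and the equivalences *)

Lemma polyfun_sum (F : 'I_3 -> tensor4 R -> R) :
  (forall i, polyfun (F i)) -> polyfun (fun T => \sum_(i < 3) F i T).
Proof.
move=> pF; apply: (@pf_ext _ (fun T => F x1 T + F x2 T + F x3 T)).
  by move=> T; rewrite sum3.
by apply: pf_add => //; apply: pf_add.
Qed.

Lemma polyfun_ddot42 (f : tensor4 R -> 'M[R]_3) :
  (forall i j, polyfun (fun T => f T i j)) ->
  forall i j, polyfun (fun T => ddot42 T (f T) i j).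
Proof.
move=> pf i j; apply: pf_ext (fun T => esym (mxE _ _ _ _)) _.
apply: polyfun_sum => k; apply: polyfun_sum => l.
by apply: pf_mul => //; apply: pf_coord.
Qed.

Lemma polyfun_d2 i j : polyfun (fun T : tensor4 R => d2 T i j).
Proof.
apply: pf_ext (fun T => esym (mxE _ _ _ _)) _.
apply: polyfun_sum => k; apply: polyfun_sum => m; apply: polyfun_sum => n.
by apply: pf_mul; apply: pf_coord.
Qed.

Lemma Cov2_d2 T : Cov2 T (d2 T).
Proof.
exists (@d2 R); split=> //; split; first exact: polyfun_d2.
split; first by move=> ? /isH4_harmonic; apply: d2_sym.
by move=> g S [gg _] _; apply: d2_act.
Qed.

Lemma Cov2_c3 T : Cov2 T (c3 T).
Proof.
exists (@c3 R); split=> //; split; first exact: polyfun_ddot42 polyfun_d2.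
split; first by move=> ? /isH4_harmonic; apply: ddot42_sym.
by move=> g S [gg _] _; apply: c3_act.
Qed.

Lemma Cov2_c4 T : Cov2 T (c4 T).
Proof.
exists (@c4 R); split=> //; split.
  exact: polyfun_ddot42 (polyfun_ddot42 polyfun_d2).
split; first by move=> ? /isH4_harmonic; apply: ddot42_sym.
by move=> g S [gg _] _; apply: c4_act.
Qed.
End SymmetryTransfer.

Theorem theorem9p16 (R : realType) (H : tensor4 R) :
  isH4 H ->
  (triclinic4 H <-> triclinic2_family (Cov2 H)) /\
  (triclinic4 H <->
     triclinic2_family (fun a => a = d2 H \/ a = c3 H \/ a = c4 H)).
Proof.
move=> hH; have hT := isH4_harmonic hH.
have fix4 g : fixes4 g H -> act4 g H = H by move=> fH; apply: tensorP.
have one_three : triclinic4 H ->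
    triclinic2_family (fun a => a = d2 H \/ a = c3 H \/ a = c4 H).
  move=> tri g oG fA; apply: contrapT => g1.
  have [||| h oh [h1 hH']] := common_symmetry_transfer hT oG g1.
  - by apply: fA; left.
  - by apply: fA; right; left.
  - by apply: fA; right; right.
  by apply: h1; apply: tri => // i j k l; rewrite hH'.
(* The cycle is closed by two easy implications: [d2], [c3], [c4] are themselves covariants, and by
   equivariance a symmetry of [H] fixes every covariant value. *)
have three_two : triclinic2_family (fun a => a = d2 H \/ a = c3 H \/ a = c4 H) ->
    triclinic2_family (Cov2 H).
  move=> tri g oG fA; apply: tri => // a [->|[->|->]]; apply: fA.
  - exact: Cov2_d2.
  - exact: Cov2_c3.
  - exact: Cov2_c4.
have two_one : triclinic2_family (Cov2 H) -> triclinic4 H.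
  move=> tri g oG /fix4 gH; apply: tri => // a [f [[_ [_ fE]] ->]].
  by rewrite -fE // gH.
by split; split=> h; auto.
Qed.
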